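(* Let $E_1$ and $E_2$ be two complex finite dimensional vector spaces and let $L_1$ and $L_2$ be two complex nilpotent Lie subalgebras of $\mathcal{L}(E_1)^{op}$ and $\mathcal{L}(E_2)^{op}$, respectively. Let $L_1\times L_2$ denote the set of operators $\{x\otimes 1+1\otimes y\colon x\in L_1,\ y\in L_2\}$, with the natural bracket of $\mathcal{L}(E_1\otimes E_2)^{op}$, viewed as the direct product of the Lie algebras $L_1$ and $L_2$. Then $$Sp(L_1\times L_2,E_1\otimes E_2)=Sp(L_1,E_1)\times Sp(L_2,E_2),$$ $$\sigma_{\delta,k}(L_1\times L_2,E_1\otimes E_2)=Sp(L_1,E_1)\times Sp(L_2,E_2),$$ $$\sigma_{\pi,k}(L_1\times L_2,E_1\otimes E_2)=Sp(L_1,E_1)\times Sp(L_2,E_2),$$ where $0\le k\le n+m$, $n=\dim L_1$ and $m=\dim L_2$.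
   Context: For a complex finite dimensional vector space $E$, $\mathcal{L}(E)$ is the algebra of all linear transformations of $E$, and $\mathcal{L}(E)^{op}$ is the same vector space with the opposite product, regarded as a Lie algebra with its commutator bracket; thus $[x,y]=yx-xy$ in terms of ordinary composition. In $x\otimes1$ and $1\otimes y$, the symbol $1$ denotes the identity map of the corresponding space. The operators $x\otimes 1$ ($x\in L_1$) and $1\otimes y$ ($y\in L_2$) commute, and in viewing $\{x\otimes 1+1\otimes y\}$ as the direct product $L_1\times L_2$ the operator $x\otimes1+1\otimes y$ corresponds to the pair $(x,y)$; a pair $(\alpha,\beta)\in L_1^*\times L_2^*$ is regarded as the functional $(\alpha,\beta)(x,y)=\alpha(x)+\beta(y)$ on $L_1\times L_2$. The joint spectra are defined as follows. Let $L$ be a complex nilpotent Lie subalgebra of $\mathcal{L}(E)^{op}$, let $N=\dim L$, and let $L^*$ be the dual vector space of $L$. For $e\in E$ and $x\in L$ write $e\cdot x:=x(e)$. A character of $L$ is an $f\in L^*$ with $f([x,y])=0$ for all $x,y\in L$. For a character $f$, $(E\otimes\wedge L,d(f))$ is the chain complex with maps $d_p(f)\colon E\otimes\wedge^pL\to E\otimes\wedge^{p-1}L$, $$d_p(f)\big(e\otimes x_1\wedge\dots\wedge x_p\big)=\sum_{k=1}^p(-1)^{k+1}\big(e\cdot x_k-f(x_k)e\big)\otimes x_1\wedge\dots\wedge\hat{x_k}\wedge\dots\wedge x_p+\sum_{1\le k<l\le p}(-1)^{k+l}e\otimes[x_k,x_l]\wedge x_1\wedge\dots\wedge\hat{x_k}\wedge\dots\wedge\hat{x_l}\wedge\dots\wedge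 x_p$$ for $1\le p\le N$ (where $\hat{\ }$ means deletion), and $d_p(f)=0$ if $p\le 0$ or $p\ge N+1$. Its homology is $H_p(E\otimes\wedge L,d(f))=\ker d_p(f)/\operatorname{im} d_{p+1}(f)$. The joint spectrum is $Sp(L,E)=\{f\in L^*\colon f \text{ is a character of } L \text{ and } H_p(E\otimes\wedge L,d(f))\neq0 \text{ for some } p\}$. For $0\le p\le N$ put $\Sigma_p(L,E)=\{f\in L^*\colon f\text{ is a character of }L\text{ and } H_p(E\otimes\wedge L,d(f))\ne0\}$. For $0\le k\le N$, $$\sigma_{\delta,k}(L,E)=\bigcup_{0\le p\le k}\Sigma_p(L,E),\qquad \sigma_{\pi,k}(L,E)=\bigcup_{k\le p\le N}\Sigma_p(L,E).$$ *)

(* Defs.v *)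
From HB Require Import structures.
From mathcomp Require Import all_boot all_order all_algebra.
From mathcomp Require Import classical_sets reals complex.

Set Implicit Arguments.
Unset Strict Implicit.
Unset Printing Implicit Defensive.

Import GRing.Theory.
Local Open Scope ring_scope.

Record lieAlg (F : fieldType) := LieAlg {
  lie_sort :> vectType F;
  lie_br : lie_sort -> lie_sort -> lie_sort;
  lie_brDl : forall y, linear (lie_br^~ y);
  lie_brDr : forall x, linear (lie_br x);
  lie_brxx : forall x, lie_br x x = 0;
  lie_jacobi : forall x y z,
    lie_br x (lie_br y z) + lie_br y (lie_br z x) + lie_br z (lie_br x y) = 0
}.

(* By bilinearity the brackets of basis vectors span [L, lcs L n]. *)
Fixpoint lie_lcs (F : fieldType) (L : lieAlg F) (n : nat) : {vspace L} :=
  if n is n'.+1 then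
    <<[seq lie_br x y | x <- vbasis {:L}, y <- vbasis (lie_lcs L n')]>>%VS
  else fullv.

Definition lie_nilpotent (F : fieldType) (L : lieAlg F) : Prop :=
  exists n, lie_lcs L n = 0%VS.

Section OpLie.
Variables (F : fieldType) (E : vectType F).

(* The bracket of L(E)^op; without the inner parentheses _ \o _ would bind   *)
(* less tightly than the subtraction.                                         *)
Definition opbr (x y : 'End(E)) : 'End(E) := ((y \o x) - (x \o y))%VF.
Lemma opbrE x y e : opbr x y e = y (x e) - x (y e).
Proof. by rewrite /opbr !lfun_simp. Qed.
Lemma opbrDl y : linear (opbr^~ y).
Proof.
move=> a u v; apply/lfunP => e.
by rewrite !(lfun_simp, opbrE) linearP scalerBr opprD addrACA.
Qed.
Lemma opbrDr x : linear (opbr x).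
Proof.
move=> a u v; apply/lfunP => e.
by rewrite !(lfun_simp, opbrE) linearP scalerBr opprD addrACA.
Qed.
Lemma opbrxx x : opbr x x = 0. Proof. exact: subrr. Qed.

Lemma opbr_jacobi x y z :
  opbr x (opbr y z) + opbr y (opbr z x) + opbr z (opbr x y) = 0.
Proof.
have aux (A B C D : E) : A - B - (C - D) = (A + D) - (B + C).
  by rewrite opprB addrACA -opprD.
have lB (f : 'End(E)) u v : f (u - v) = f u - f v by rewrite linearB.
have tel (A B C : E) : A - B + (B - C) = A - C by rewrite addrA subrK.
apply/lfunP => e; rewrite !(add_lfunE, opbrE) !lB !aux zero_lfunE.
rewrite [y (z (x e)) + _]addrC tel [z (x (y e)) + _]addrC tel.
by rewrite [z _ + _]addrC subrr.
Qed.

Record lieSubalg := LieSubalg {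
  lsub_space :> {vspace 'End(E)};
  lsub_closed : forall x y,
    x \in lsub_space -> y \in lsub_space -> opbr x y \in lsub_space
}.

Section SubLie.
Variable L : lieSubalg.

Definition lsub_br (x y : subvs_of L) : subvs_of L :=
  Subvs (lsub_closed (subvsP x) (subvsP y)).

Fact lsub_brDl y : linear (lsub_br^~ y).
Proof. by move=> a u v; apply: val_inj; rewrite /= opbrDl. Qed.
Fact lsub_brDr x : linear (lsub_br x).
Proof. by move=> a u v; apply: val_inj; rewrite /= opbrDr. Qed.
Fact lsub_brxx x : lsub_br x x = 0.
Proof. by apply: val_inj; rewrite /= opbrxx. Qed.
Fact lsub_jacobi x y z :
  lsub_br x (lsub_br y z) + lsub_br y (lsub_br z x) + lsub_br z (lsub_br x y)
  = 0.
Proof. by apply: val_inj; rewrite /= opbr_jacobi. Qed.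

Definition lie_of_sub : lieAlg F :=
  LieAlg lsub_brDl lsub_brDr lsub_brxx lsub_jacobi.

End SubLie.
End OpLie.

Coercion lie_of_sub : lieSubalg >-> lieAlg.

Section LieProd.
Variables (F : fieldType) (L1 L2 : lieAlg F).

Definition prod_br (u v : L1 * L2) : L1 * L2 :=
  (lie_br u.1 v.1, lie_br u.2 v.2).

Fact prod_brDl y : linear (prod_br^~ y).
Proof. by move=> a u v; rewrite /prod_br /= !lie_brDl. Qed.
Fact prod_brDr x : linear (prod_br x).
Proof. by move=> a u v; rewrite /prod_br /= !lie_brDr. Qed.
Fact prod_brxx x : prod_br x x = 0.
Proof. by rewrite /prod_br !lie_brxx. Qed.
Fact prod_jacobi x y z :
  prod_br x (prod_br y z) + prod_br y (prod_br z x) + prod_br z (prod_br x y)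
  = 0.
Proof. by congr (_, _); rewrite /= lie_jacobi. Qed.

Definition lie_prod : lieAlg F :=
  @LieAlg F (L1 * L2)%type prod_br prod_brDl prod_brDr prod_brxx prod_jacobi.

End LieProd.

(* Homomorphisms of Lie algebras L -> L(E)^op.  A Lie subalgebra of L(E)^op   *)
(* is seen as its inclusion map.  The homomorphism is not required to be      *)
(* injective: (x, y) |-> x (x) 1 + 1 (x) y kills (1, -1) when both L1 and L2  *)
(* contain the identity.                                                      *)
Record opRep (F : fieldType) (L : lieAlg F) (E : vectType F) := OpRep {
  rep_fun :> 'Hom(L, 'End(E));
  rep_br : forall x y, rep_fun (lie_br x y) = opbr (rep_fun x) (rep_fun y)
}.

Section RepIncl.
Variables (F : fieldType) (E : vectType F) (L : lieSubalg E).

Definition incl_fun : 'Hom(lie_of_sub L, 'End(E)) :=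
  linfun (vsval : subvs_of L -> 'End(E)).

Fact incl_br x y : incl_fun (lie_br x y) = opbr (incl_fun x) (incl_fun y).
Proof. by rewrite !lfunE. Qed.

Definition rep_incl : opRep L E := OpRep incl_br.

End RepIncl.

Definition dual (F : fieldType) (V : vectType F) : vectType F := 'Hom(V, F^o).

Section DualPair.
Variables (F : fieldType) (L1 L2 : lieAlg F).

Definition dual_pair_fun (a : dual L1) (b : dual L2) (v : L1 * L2) : F^o :=
  a v.1 + b v.2.

Fact dual_pair_linear a b : linear (dual_pair_fun a b).
Proof.
move=> c u v; rewrite /dual_pair_fun /= !linearP /=.
by rewrite scalerDr addrACA.
Qed.
HB.instance Definition _ a b := GRing.isLinear.Build F (L1 * L2)%type F^o _
  (dual_pair_fun a b) (dual_pair_linear a b).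

Definition dual_pair (a : dual L1) (b : dual L2) : dual (lie_prod L1 L2) :=
  linfun (dual_pair_fun a b).

Lemma dual_pairE a b v : dual_pair a b v = a v.1 + b v.2.
Proof. by rewrite lfunE. Qed.

End DualPair.

(* The tensor product E1 (x) E2, realized as Hom(E1^*, E2), the vector        *)
(* e1 (x) e2 being phi |-> phi(e1) e2.                                        *)
Section Tensor.
Variables (F : fieldType) (E1 E2 : vectType F).

Definition tensor : vectType F := 'Hom(dual E1, E2).

Definition tens_fun (e1 : E1) (e2 : E2) (phi : dual E1) : E2 := phi e1 *: e2.

Fact tens_fun_linear e1 e2 : linear (tens_fun e1 e2).
Proof.
move=> a u v; rewrite /tens_fun add_lfunE scale_lfunE scalerDl.
by rewrite -scalerA.
Qed.
HB.instance Definition _ e1 e2 := GRing.isLinear.Build F (dual E1) E2 _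
  (tens_fun e1 e2) (tens_fun_linear e1 e2).

Definition tens (e1 : E1) (e2 : E2) : tensor := linfun (tens_fun e1 e2).

Lemma tensE e1 e2 phi : tens e1 e2 phi = phi e1 *: e2.
Proof. by rewrite lfunE. Qed.

Lemma tens_linearl e2 : linear (tens^~ e2).
Proof.
move=> a u v; apply/lfunP => phi.
by rewrite add_lfunE scale_lfunE !tensE linearP scalerDl -scalerA.
Qed.

Lemma tens_linearr e1 : linear (tens e1).
Proof.
move=> a u v; apply/lfunP => phi.
by rewrite add_lfunE scale_lfunE !tensE scalerDr !scalerA mulrC.
Qed.

HB.instance Definition _ e1 := GRing.isLinear.Build F E2 tensor _
  (tens e1) (tens_linearr e1).

Lemma tens_basis :
  basis_of {:tensor} [seq tens e1 e2 | e1 <- vbasis {:E1}, e2 <- vbasis {:E2}].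
Proof.
rewrite basisEdim; apply/andP; split; last first.
  rewrite size_allpairs !size_tuple !dimvf /dim /= /dim /= muln1.
  by rewrite leqnn.
apply/subvP => T _.
pose b := vbasis {:E1}; pose bs i : dual E1 := linfun (coord b i : E1 -> F^o).
have -> : T = \sum_(i < \dim {:E1}) tens b`_i (T (bs i)).
  apply/lfunP => phi; rewrite sum_lfunE.
  have Dphi : phi = \sum_(i < \dim {:E1}) phi b`_i *: bs i.
    apply/lfunP => v; rewrite sum_lfunE {1}(coord_vbasis (memvf v)).
    rewrite linear_sum; apply: eq_bigr => i _.
    by rewrite linearZ /= scale_lfunE lfunE /=; exact: mulrC.
  rewrite {1}Dphi linear_sum; apply: eq_bigr => i _.
  by rewrite linearZ tensE.
apply: memv_suml => i _; rewrite (coord_vbasis (memvf (T (bs i)))).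
rewrite linear_sum memv_suml // => j _; rewrite linearZ memvZ //=.
by apply/memv_span/allpairsP; exists (b`_i, (vbasis {:E2})`_j);
  rewrite /= !mem_nth ?size_tuple.
Qed.

Lemma tens_lfunP (G : vectType F) (f g : 'Hom(tensor, G)) :
  (forall e1 e2, f (tens e1 e2) = g (tens e1 e2)) -> f = g.
Proof.
move=> fg; apply/lfunP => T.
have /andP[/eqP sp _] := tens_basis.
have: T \in <<[seq tens e1 e2 | e1 <- vbasis {:E1}, e2 <- vbasis {:E2}]>>%VS.
  by rewrite sp memvf.
move/(@coord_span _ _ _ (in_tuple _)) => ->; rewrite !linear_sum; apply: eq_bigr => i _.
rewrite !linearZ /=; congr (_ *: _).
have /allpairsP[[e1 e2] [_ _ ->]] := mem_nth 0 (ltn_ord i).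
exact: fg.
Qed.

Section Op.
Variables (x : 'End(E1)) (y : 'End(E2)).

Definition dual_map_fun (phi : dual E1) : dual E1 := (phi \o x)%VF.

Fact dual_map_linear : linear dual_map_fun.
Proof.
by move=> a u v; rewrite /dual_map_fun comp_lfunDl comp_lfunZl.
Qed.
HB.instance Definition _ := GRing.isLinear.Build F (dual E1) (dual E1) _
  dual_map_fun dual_map_linear.

Definition tens_op_fun (T : tensor) : tensor :=
  (y \o (T \o linfun dual_map_fun))%VF.

Fact tens_op_funE T phi : tens_op_fun T phi = y (T (phi \o x)%VF).
Proof. by rewrite /tens_op_fun !comp_lfunE lfunE. Qed.

Fact tens_op_linear : linear tens_op_fun.
Proof.
move=> a u v; apply/lfunP => phi.
rewrite add_lfunE scale_lfunE !tens_op_funE add_lfunE scale_lfunE.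
by rewrite linearP.
Qed.
HB.instance Definition _ := GRing.isLinear.Build F tensor tensor _
  tens_op_fun tens_op_linear.

(* x (x) y *)
Definition tens_op : 'End(tensor) := linfun tens_op_fun.

Lemma tens_opE e1 e2 : tens_op (tens e1 e2) = tens (x e1) (y e2).
Proof.
apply/lfunP => phi.
by rewrite lfunE /= tens_op_funE !tensE linearZ /= comp_lfunE.
Qed.

End Op.
End Tensor.

(* L1 x L2 acting on E1 (x) E2, the pair (x, y) by x (x) 1 + 1 (x) y. *)
Section RepTens.
Variables (F : fieldType) (E1 E2 : vectType F).
Variables (L1 : lieSubalg E1) (L2 : lieSubalg E2).

Definition tens_sum_fun (v : L1 * L2) : 'End(tensor E1 E2) :=
  tens_op (rep_incl L1 v.1) \1%VF + tens_op \1%VF (rep_incl L2 v.2).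

Fact tens_sum_linear : linear tens_sum_fun.
Proof.
move=> a u v; apply: tens_lfunP => e1 e2.
rewrite /tens_sum_fun !(add_lfunE, scale_lfunE, tens_opE) !id_lfunE.
by rewrite !linearP /= !(add_lfunE, scale_lfunE) tens_linearl tens_linearr
           scalerDr addrACA.
Qed.
HB.instance Definition _ := GRing.isLinear.Build F (L1 * L2)%type
  'End(tensor E1 E2) _ tens_sum_fun tens_sum_linear.

Definition tens_rep_fun : 'Hom(lie_prod L1 L2, 'End(tensor E1 E2)) :=
  linfun tens_sum_fun.

Fact tens_rep_br u v :
  tens_rep_fun (lie_br u v) = opbr (tens_rep_fun u) (tens_rep_fun v).
Proof.
apply: tens_lfunP => e1 e2; rewrite opbrE !lfunE /= /tens_sum_fun.
rewrite !(add_lfunE, tens_opE, id_lfunE, rep_br, opbrE).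
have aux (G : zmodType) (P Q U S P' S' : G) :
    P + Q + (U + S) - (P' + U + (Q + S')) = (P - P') + (S - S').
  rewrite [U + S]addrC [Q + S']addrC (addrACA P) (addrACA P') [U + Q]addrC.
  by rewrite opprD [LHS]addrACA subrr addr0 opprD [LHS]addrACA.
have tBl (w1 w2 : E1) e : tens (w1 - w2) e = tens w1 e - tens w2 e.
  by rewrite -[w1 - w2]addrC -scaleN1r tens_linearl scaleN1r addrC.
have fD (f : 'End(tensor E1 E2)) a b : f (a + b) = f a + f b.
  by rewrite linearD.
by rewrite !fD !tens_opE !id_lfunE tBl linearB aux.
Qed.

Definition rep_tens : opRep (lie_prod L1 L2) (tensor E1 E2) :=
  OpRep tens_rep_br.

Lemma rep_tensE (x : L1) (y : L2) :
  rep_tens (x, y) = tens_op (vsval x) \1%VF + tens_op \1%VF (vsval y).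
Proof. by rewrite lfunE /= /tens_sum_fun !lfunE. Qed.

End RepTens.

Section Koszul.
Variables (F : fieldType) (L : lieAlg F) (E : vectType F) (rho : opRep L E).

(* E (x) /\L.  With b_0, ..., b_(N-1) the basis [vbasis {:L}] of L, z stands  *)
(* for the sum over the sets S = {s_1 < ... < s_p} of                         *)
(* z S (x) b_(s_1) /\ ... /\ b_(s_p).                                         *)
Definition chains : vectType F := {ffun {set 'I_(\dim {:L})} -> E}.

(* E (x) /\^p L *)
Definition in_degree (p : nat) (z : chains) : Prop :=
  forall S : {set 'I_(\dim {:L})}, #|S| != p -> z S = 0.

Definition basis_seq (S : {set 'I_(\dim {:L})}) : seq L :=
  [seq (vbasis {:L})`_i | i : 'I_(\dim {:L}) <- enum S].

(* e (x) x_1 /\ ... /\ x_p.  The coefficient of x_1 /\ ... /\ x_p at S is the *)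
(* minor with columns S of the matrix of coordinates of x_1, ..., x_p.        *)
Definition ewedge (e : E) (xs : seq L) : chains :=
  [ffun S : {set 'I_(\dim {:L})} =>
     if #|S| == size xs then
       \det (\matrix_(i < size xs, j < size xs)
               [seq coord (vbasis {:L}) s xs`_i | s <- enum S]`_j) *: e
     else 0].

Lemma ewedge_basis e S :
  ewedge e (basis_seq S) = [ffun T => if T == S then e else 0].
Proof.
have sz : size (basis_seq S) = #|S| by rewrite size_map -cardE.
have xsE s0 i : (i < #|S|)%N ->
    (basis_seq S)`_i = (vbasis {:L})`_(nth s0 (enum S) i).
  by move=> ltiS; rewrite (nth_map s0) // -cardE.
have s0P (A : {set 'I_(\dim {:L})}) i :
    (i < #|A|)%N -> exists s0 : 'I_(\dim {:L}), s0 \in A.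
  by move=> ltiA; apply/card_gt0P; apply: leq_ltn_trans ltiA.
have free_b : free (vbasis {:L}) by apply: basis_free (vbasisP _).
apply/ffunP => T; rewrite !ffunE; case: (altP (T =P S)) => [->|neTS].
  rewrite sz eqxx -[RHS]scale1r; congr (_ *: _).
  rewrite -(det1 F #|S|); congr (\det _); apply/matrixP => i j; rewrite !mxE.
  have [s0 _] := s0P _ _ (ltn_ord i).
  rewrite (nth_map s0) -?cardE // (xsE s0) // coord_free //.
  by rewrite nth_uniq -?cardE ?enum_uniq.
case: ifP => // /eqP cTS; rewrite [X in X *: _](_ : _ = 0) ?scale0r //.
have [t tT tS] : exists2 t, t \in T & t \notin S.
  by apply/subsetPn; apply: contra neTS; rewrite eqEcard cTS sz leqnn andbT.
have ltj : (index t (enum T) < size (basis_seq S))%N.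
  by rewrite -cTS cardE index_mem mem_enum.
rewrite (expand_det_col _ (Ordinal ltj)) big1 // => i _; rewrite mxE.
have ltiS : (i < #|S|)%N by rewrite -sz.
rewrite (nth_map t) /=; last by rewrite index_mem mem_enum.
rewrite nth_index ?mem_enum // (xsE t) // coord_free //.
case: eqP => [tE|_]; last by rewrite mul0r.
have: nth t (enum S) i \in enum S by rewrite mem_nth // -cardE.
by rewrite tE mem_enum (negPf tS).
Qed.

Definition del (k : nat) (xs : seq L) : seq L := take k xs ++ drop k.+1 xs.

(* d(f)(e (x) x_0 /\ ... /\ x_(p-1)), with indices starting from 0.           *)
Definition dwedge (f : dual L) (e : E) (xs : seq L) : chains :=
  \sum_(k < size xs)
     (-1) ^+ k *: ewedge (rho xs`_k e - (f xs`_k : F) *: e) (del k xs)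
  + \sum_(k < size xs) \sum_(l < size xs | (k < l)%N)
     (-1) ^+ (k + l) *: ewedge e (lie_br xs`_k xs`_l :: del k (del l xs)).

(* The linear map with e (x) b_S |-> dwedge f e (basis_seq S); see            *)
(* ewedge_basis.                                                              *)
Definition dkoszul (f : dual L) (z : chains) : chains :=
  \sum_(S : {set 'I_(\dim {:L})}) dwedge f (z S) (basis_seq S).

Definition lie_character (f : dual L) : Prop :=
  forall x y, f (lie_br x y) = 0.

Definition cycle (f : dual L) (p : nat) (z : chains) : Prop :=
  in_degree p z /\ dkoszul f z = 0.

Definition boundary (f : dual L) (p : nat) (z : chains) : Prop :=
  exists2 w, in_degree p.+1 w & dkoszul f w = z.

(* H_p(E (x) /\L, d(f)) <> 0 *)
Definition homology_neq0 (f : dual L) (p : nat) : Prop :=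
  exists2 z, cycle f p z & ~ boundary f p z.

Local Open Scope classical_set_scope.

Definition Sp : set (dual L) :=
  [set f | lie_character f /\ exists p, homology_neq0 f p].

Definition Sigma (p : nat) : set (dual L) :=
  [set f | lie_character f /\ homology_neq0 f p].

Definition sigma_delta (k : nat) : set (dual L) :=
  \bigcup_(p in [set p | (p <= k)%N]) Sigma p.

Definition sigma_pi (k : nat) : set (dual L) :=
  \bigcup_(p in [set p | (k <= p <= \dim {:L})%N]) Sigma p.

End Koszul.

(* Main.v *)
From HB Require Import structures.
Require Import Defs.
From mathcomp Require Import all_boot all_order all_algebra.
From mathcomp Require Import boolp classical_sets reals complex.

(** A character [f] is called a weight of a representation [rho] of [L] when
    some [e != 0] satisfies [rho x e = f x *: e] for all [x].  For nilpotent
    [L] the joint spectrum is the set of weights, and so is each of the sets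
    [sigma_delta k] and [sigma_pi k].  Since [sigma_delta k] contains [Sigma 0]
    and [sigma_pi k] contains [Sigma N], [N] being the dimension of [L], this
    only takes two facts: a nonzero homology space in any degree produces a
    weight vector, and a weight vector produces homology in the degrees [0] and
    [N].  The theorem then reduces to the fact that the weights of the tensor
    product are the pairs of weights ([weights_tensor]).

    Replace [rho] by [A = rho - f], so that weight vectors become vectors killed
    by all the [A x].  Let [x] act on chains by the Lie derivative, which is
    [A x] on the coefficients minus the derivation extending [ad x].  Cartan's
    formula ([koszul_wedge]) says that exterior multiplication by [x] is a
    homotopy from this Lie derivative to [0]; hence [L] maps cycles into
    boundaries.  If some cycle is not a boundary, the cycles are therefore not
    spanned by their images under [L], and Fitting's lemma together with Engel's
    theorem gives a nonzero chain killed by [L] ([null_vector_of_quotient]).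
    On that chain [A x] acts as the nilpotent derivation [ad x], so its
    coefficients are killed by a power of each [A x], and Engel's theorem
    applies again ([null_vector_of_homology]).

    Conversely let [e] be killed by all the [A x].  In degree [N] the chain
    [e (x) b_0 /\ ... /\ b_(N-1)] is a cycle because [ad x] has trace zero
    ([koszul_top_chain]).  In degree [0] one needs a linear form vanishing on
    all the images of the [A x]; it comes from [null_vector_of_quotient] applied
    to the dual representation, whose images lie in the hyperplane of the forms
    that vanish at [e] ([conull_of_null]).

    The differential is handled through the operators that insert a basis vector
    of [L] into an exterior monomial and contract with its dual basis vector.
    They satisfy the canonical anticommutation relations ([contract_insert],
    [insert_insert]), every chain is built from degree [0] by exterior
    multiplications ([chains_ind]), and the expansion of the minors that define
    exterior products is confined to [ewedge_cons]. *)

Set Implicit Arguments.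
Unset Strict Implicit.
Unset Printing Implicit Defensive.

Import GRing.Theory.
Local Open Scope ring_scope.

(** * Linear algebra *)

Section Linear.
Variables (F : fieldType) (V : vectType F).

(** Subspaces of a finite dimensional space given by a property, such as cycles
    or generalized null vectors, become subspaces with a dimension: take one of
    maximal dimension inside the property. *)
Lemma vspace_of_pred (P : V -> Prop) :
    P 0 -> (forall a u v, P u -> P v -> P (a *: u + v)) ->
  exists W : {vspace V}, forall v, v \in W <-> P v.
Proof.
move=> P0 PD.
have [W WP Wmax] : exists2 W : {vspace V}, (forall v, v \in W -> P v) &
    forall W' : {vspace V}, (forall v, v \in W' -> P v) -> (\dim W' <= \dim W)%N.
  pose Q := [pred n | `[< exists2 W : {vspace V},
    (forall v, v \in W -> P v) & \dim W = n >]].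
  have exQ : exists n, Q n.
    exists 0; apply/asboolP; exists 0%VS; last exact: dimv0.
    by move=> v; rewrite memv0 => /eqP->.
  have ubQ n : Q n -> (n <= \dim {:V})%N.
    by move/asboolP => [W _ <-]; apply/dimvS/subvf.
  case: (ex_maxnP exQ ubQ) => n /asboolP[W WP <-] nmax.
  by exists W => // W' W'P; apply: nmax; apply/asboolP; exists W'.
exists W => v; split; first exact: WP.
move=> Pv; have: (\dim (W + <[v]>) <= \dim W)%N.
  apply: Wmax => _ /memv_addP[w /WP Pw [_ /vlineP[a ->] ->]].
  by rewrite addrC; apply: PD.
rewrite (geq_leqif (dimv_leqif_sup (addvSl W <[v]>))).
by rewrite subv_add -memvE => /andP[].
Qed.

(** The images of [U] under the powers of [T] stabilize, so that
    [T ^ M z = T ^ (M + 1) q] for some [q] in [U].  This is Fitting's lemma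
    without the splitting of [U]. *)
Lemma fitting_vector (T : 'End(V)) (U : {vspace V}) z :
    (forall v, v \in U -> T v \in U) -> z \in U ->
  exists2 q, q \in U & exists M, iter M T (z - T q) = 0.
Proof.
move=> TU Uz.
pose X M := iter M (fun W => T @: W)%VS U.
have XP M v : v \in X M -> exists2 u, u \in U & v = iter M T u.
  elim: M v => [|M IH] v /=; first by exists v.
  by case/memv_imgP => w /IH[u Uu ->] ->; exists u.
have XI M u : u \in U -> iter M T u \in X M.
  by move=> Uu; elim: M => //= M IH; apply: memv_img.
have XS M : (X M.+1 <= X M)%VS.
  elim: M => [|M IH] /=; last exact: limgS.
  by apply/subvP => _ /memv_imgP[u Uu ->]; apply: TU.
have [M eqX] : exists M, X M.+1 = X M.
  apply: contrapT => /forallNP neqX.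
  have dimX M : (\dim (X M) + M <= \dim U)%N.
    elim: M => [|M IH]; first by rewrite addn0.
    apply: leq_trans IH; rewrite addnS -addSn leq_add2r ltn_neqAle dimvS // andbT.
    by apply/negP => eqd; apply: (neqX M); apply/eqP; rewrite eqEdim XS /= (eqP eqd).
  by have := dimX (\dim U).+1; rewrite addnS ltnNge leq_addl.
have := XI M z Uz; rewrite -eqX => /XP[q Uq eqz].
exists q => //; exists M.
have iterB n u v : iter n T (u - v) = iter n T u - iter n T v.
  by elim: n => //= n ->; rewrite linearB.
by rewrite iterB -iterSr -eqz subrr.
Qed.

End Linear.

Lemma iter_additive0 (V : zmodType) (T : {additive V -> V}) n : iter n T 0 = 0.
Proof. by elim: n => //= n ->; rewrite raddf0. Qed.

Lemma iter_additiveD (V : zmodType) (T : {additive V -> V}) n u v :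
  iter n T (u + v) = iter n T u + iter n T v.
Proof. by elim: n => //= n ->; rewrite raddfD. Qed.

(** If commuting with [T] turns [S 0] into [S 1], then [S 1] into [S 2], and so
    on down to [S K = 0], then [S 0] preserves the vectors killed by a power of
    [T]: each occurrence of [T] either passes to the right of [S j] or raises
    [j]. *)
Lemma iter_commutator (V : zmodType) (T : {additive V -> V})
    (S : nat -> {additive V -> V}) K :
    (forall j v, T (S j v) = S j (T v) + S j.+1 v) -> (forall v, S K v = 0) ->
  forall M v, iter M T v = 0 -> iter (M + K) T (S 0 v) = 0.
Proof.
move=> TS SK; suff H d j : (j + d)%N = K -> forall M v, iter M T v = 0 ->
    iter (M + d) T (S j v) = 0 by move=> M v; apply: H.
elim: d j => [|d IHd] j jK M v.
  by move=> _; rewrite -jK addn0 in SK; rewrite SK iter_additive0.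
elim: M v => [|M IHM] v Mv; first by rewrite [v]Mv raddf0 iter_additive0.
rewrite addSn iterSr TS iter_additiveD IHM -?iterSr // add0r.
by rewrite addnS -addSn IHd // addSnnS.
Qed.

Lemma iter_null_mono (V : zmodType) (T : {additive V -> V}) m n v :
  (m <= n)%N -> iter m T v = 0 -> iter n T v = 0.
Proof. by move=> /subnK <- Hm; rewrite iterD Hm iter_additive0. Qed.

(** The cancellation of mixed terms in the commutator of two differences
    [a - b] and [a' - b'] of operators such that the [a]s commute with the [b]s. *)
Lemma cross_terms_cancel (V : zmodType) (p q r s u v : V) :
  p - u - (v - s) - (q - v - (u - r)) = p - q - (r - s).
Proof.
have -> : p - u - (v - s) = p + s - (u + v) by rewrite opprB addrACA -opprD.
have -> : q - v - (u - r) = q + r - (u + v).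
  by rewrite opprB addrACA -opprD [v + u]addrC.
by rewrite !opprB [LHS]addrA subrK addrACA -opprD.
Qed.

(** * Nilpotent Lie algebras *)

Section Lie.
Variables (F : fieldType) (L : lieAlg F).

HB.instance Definition _ x :=
  GRing.isLinear.Build F L L _ (lie_br x) (@lie_brDr F L x).

Lemma lie_brN x y : lie_br x y = - lie_br y x :> L.
Proof.
have brD u v w : lie_br (u + v) w = lie_br u w + lie_br v w :> L.
  by have := lie_brDl w 1 u v; rewrite !scale1r.
have := lie_brxx (x + y); rewrite brD !linearD /= !lie_brxx add0r addr0.
by move/eqP; rewrite addr_eq0 => /eqP.
Qed.

Lemma lie_br_jacobi (x y z : L) :
  lie_br (lie_br x y) z = lie_br x (lie_br y z) - lie_br y (lie_br x z).
Proof.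
have := lie_jacobi x y z; rewrite (lie_brN (lie_br x y)) (lie_brN x z) linearN.
by rewrite opprK => /eqP; rewrite addr_eq0 => /eqP.
Qed.

Lemma lcs_lie_br n (x y : L) : y \in lie_lcs L n -> lie_br x y \in lie_lcs L n.+1.
Proof.
move=> Ly; rewrite lie_brN memvN (coord_vbasis (memvf x)) linear_sum.
apply: memv_suml => i _; rewrite linearZ memvZ //= lie_brN memvN.
rewrite (coord_vbasis Ly) linear_sum; apply: memv_suml => j _.
rewrite linearZ memvZ //=; apply/memv_span/allpairsP.
by exists ((vbasis {:L})`_i, (vbasis (lie_lcs L n))`_j);
  split; rewrite //= mem_nth ?size_tuple.
Qed.

(** Generators of the lower central series are brackets of basis vectors only;
    this is the universal property for all brackets. *)
Lemma lcs_least n (W : {vspace L}) :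
    (forall x y, y \in lie_lcs L n -> lie_br x y \in W) ->
  (lie_lcs L n.+1 <= W)%VS.
Proof.
move=> brW; apply/span_subvP => _ /allpairsP[[x y] /= [_ y_lcs ->]].
by apply/brW/vbasis_mem.
Qed.

Lemma lcs_iter n (x y : L) : iter n (lie_br x) y \in lie_lcs L n.
Proof. by elim: n => [|n IH]; rewrite ?memvf //; apply: lcs_lie_br. Qed.

Lemma lcs_eq0_mono m n : (m <= n)%N -> lie_lcs L m = 0%VS -> lie_lcs L n = 0%VS.
Proof.
move/subnK <-; elim: (n - m)%N => // d IH /IH IH0; rewrite addSn.
apply/eqP; rewrite -subv0; apply: lcs_least => x y.
by rewrite IH0 memv0 => /eqP ->; rewrite linear0 mem0v.
Qed.

End Lie.

Section Engel.
Variables (F : fieldType) (L : lieAlg F) (E : vectType F) (A : opRep L E).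

Definition rep_stable (U : {vspace E}) := forall x v, v \in U -> A x v \in U.

Lemma rep_comm x y v : A x (A y v) = A y (A x v) + A (lie_br y x) v.
Proof. by rewrite rep_br opbrE addrC subrK. Qed.

Definition gen_null x v := exists M, iter M (A x) v = 0.

Lemma gen_null_linear x a u v :
  gen_null x u -> gen_null x v -> gen_null x (a *: u + v).
Proof.
move=> [M Mu] [K Kv]; exists (maxn M K).
rewrite iter_additiveD (iter_null_mono _ Kv) ?leq_maxr // addr0.
have -> : iter (maxn M K) (A x) (a *: u) = a *: iter (maxn M K) (A x) u.
  by elim: (maxn M K) => //= n ->; rewrite linearZ.
by rewrite (iter_null_mono _ Mu) ?leq_maxl // scaler0.
Qed.

Hypothesis nilL : lie_nilpotent L.

(** The iterated brackets of [y] with [x] vanish eventually, so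
    [iter_commutator] applies to the operators that they induce. *)
Lemma gen_null_stable x y v : gen_null x v -> gen_null x (A y v).
Proof.
case: nilL => K lcsK [M Mv]; exists (M + K)%N.
pose z j := iter j (fun u => lie_br u x) y.
have zE j : z j = (-1) ^+ j *: iter j (lie_br x) y.
  rewrite /z; elim: j => [|j IH] /=; first by rewrite scale1r.
  by rewrite IH lie_brN linearZ /= exprS mulN1r scaleNr.
apply: (iter_commutator (S := fun j => A (z j))) (Mv) => [j u|u].
  exact: rep_comm.
have /eqP-> : z K == 0 by rewrite -memv0 -lcsK zE memvZ // lcs_iter.
by rewrite linear0 /= zero_lfunE.
Qed.

(** Engel's theorem.  It is enough to treat [U] minimal among the nonzero stable
    subspaces.  If the brackets [[y, x]] act as zero on [U], then the kernel of
    [A x] in [U] is stable, and nonzero since [A x] is nilpotent, so [A x] is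
    zero on [U].  This climbs the lower central series from [0] up to [L]. *)
Lemma engel (U : {vspace E}) :
    rep_stable U -> U != 0%VS -> (forall x v, v \in U -> gen_null x v) ->
  exists2 v, v != 0 & forall x, A x v = 0.
Proof.
have [n] := ubnP (\dim U); elim: n => // n IH in U *; rewrite ltnS => leUn stU U0 nU.
have [[W sWU [stW W0 ltWU]]|irrU] := pselect (exists2 W : {vspace E}, (W <= U)%VS
    & [/\ rep_stable W, W != 0%VS & (\dim W < \dim U)%N]).
  apply: IH stW W0 _; first exact: leq_trans leUn.
  by move=> x v /(subvP sWU); apply: nU.
have kerU x : (forall y v, v \in U -> A (lie_br y x) v = 0) ->
    forall v, v \in U -> A x v = 0.
  move=> Axy; pose W := (U :&: lker (A x))%VS.
  have memW v : (v \in W) = (v \in U) && (A x v == 0) by rewrite memv_cap memv_ker.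
  have stW : rep_stable W.
    move=> y v; rewrite !memW => /andP[Uv /eqP Av0].
    by rewrite stU //= rep_comm Av0 Axy // linear0 addr0.
  have W0 : W != 0%VS.
    have [M MU] := nU x _ (memv_pick U).
    have := U0; rewrite -vpick0 => pU.
    have exM : exists M, iter M (A x) (vpick U) == 0 by exists M; apply/eqP.
    have [m Pm mmin] := ex_minnP exM.
    case: m Pm mmin => [|m] Pm mmin; first by rewrite /= (negPf pU) in Pm.
    apply/negP => /eqP W0; have: iter m (A x) (vpick U) \in W.
      rewrite memW -iterS Pm andbT; elim: m {Pm mmin} => [|m IHm]; first exact: memv_pick.
      exact: stU.
    by rewrite W0 memv0 => /mmin; rewrite ltnn.
  have eqWU : W = U.
    apply/eqP; rewrite eqEdim capvSl leqNgt; apply/negP => ltWU.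
    by apply: irrU; exists W; rewrite ?capvSl.
  by move=> v; rewrite -{1}eqWU memW => /andP[_ /eqP].
case: nilL => K lcsK.
have kill j : (j <= K)%N -> forall x v, x \in lie_lcs L (K - j) -> v \in U -> A x v = 0.
  elim: j => [_|j IHj ltjK] x v.
    by rewrite subn0 lcsK memv0 => /eqP-> _; rewrite linear0 zero_lfunE.
  move=> xj; apply: kerU => y u; apply: IHj; first exact: ltnW.
  by rewrite -subnSK // lcs_lie_br.
exists (vpick U); first by rewrite vpick0.
by move=> x; apply: (kill K) (memv_pick U); rewrite ?subnn //= memvf.
Qed.

(** Nonzero coinvariants force a nonzero invariant vector: if [U] is not spanned
    by the images [A x U], some nonzero vector is killed by all the [A x].
    When every [A x] is nilpotent on [U] this is Engel's theorem.  Otherwise some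
    generalized null space [K] of an [A x] is a proper stable subspace of [U];
    as [U = K + A x U] by Fitting's lemma, [K] inherits the hypothesis. *)
Lemma null_vector_of_quotient (U W : {vspace E}) :
    rep_stable U -> (forall x v, v \in U -> A x v \in W) -> ~~ (U <= W)%VS ->
  exists2 v, v != 0 & forall x, A x v = 0.
Proof.
have [n] := ubnP (\dim U); elim: n => // n IH in U *; rewrite ltnS => leUn stU AUW nUW.
have [nilU|/existsNP[x /existsNP[v /not_implyP[Uv nv]]]] :=
  pselect (forall x v, v \in U -> gen_null x v).
  by apply: (engel stU) nilU; apply: contraNneq nUW => ->; exact: sub0v.
have [|a u w [Uu nu] [Uw nw]|K KP] :=
    @vspace_of_pred _ _ (fun v => v \in U /\ gen_null x v).
- by rewrite mem0v; split => //; exists 0.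
- by rewrite memvD ?memvZ //; split => //; apply: gen_null_linear.
have sKU : (K <= U)%VS by apply/subvP => u /KP[].
apply: (IH K).
- apply: leq_trans leUn; rewrite ltn_neqAle dimvS // andbT; apply/negP => eqd.
  have /eqP eKU : K == U by rewrite eqEdim sKU (eqP eqd) leqnn.
  by apply: nv; move: Uv; rewrite -eKU => /KP[].
- by move=> y u /KP[Uu nu]; apply/KP; split; [apply: stU | apply: gen_null_stable].
- by move=> y u /(subvP sKU); apply: AUW.
apply: contra nUW => sKW; apply/subvP => z Uz.
have [q Uq nq] := fitting_vector (stU x) Uz.
rewrite -(subrK (A x q) z) memvD ?AUW //; apply: (subvP sKW); apply/KP.
by split => //; rewrite memvB // stU.
Qed.

End Engel.

(** * The contragredient representation *)

Section Dual.
Variables (F : fieldType) (E : vectType F).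

Lemma dual_separates (e : E) : e != 0 -> exists phi : dual E, phi e != 0.
Proof.
move=> e0; apply: contrapT => /forallNP noPhi; case/eqP: e0.
rewrite (coord_vbasis (memvf e)) big1 // => i _.
have /negP := noPhi (linfun (coord (vbasis {:E}) i : E -> F^o)).
by rewrite negbK lfunE /= => /eqP->; rewrite scale0r.
Qed.

Variables (L : lieAlg F) (A : opRep L E).

(** The sign makes the contragredient action a homomorphism into the algebra
    with the opposite product again. *)
Definition dual_op (x : L) (phi : dual E) : dual E := - (phi \o A x)%VF.

Fact dual_op_linear x : linear (dual_op x).
Proof.
by move=> a u v; rewrite /dual_op comp_lfunDl -comp_lfunZl opprD scalerN.
Qed.
HB.instance Definition _ x :=
  GRing.isLinear.Build F (dual E) (dual E) _ (dual_op x) (dual_op_linear x).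

Definition dual_rep_fun (x : L) : 'End(dual E) := linfun (dual_op x).

Fact dual_rep_linear : linear dual_rep_fun.
Proof.
move=> a u v; apply/lfunP => phi; apply/lfunP => e.
have funE w : dual_rep_fun w phi e = - phi (A w e).
  by rewrite lfunE /= opp_lfunE comp_lfunE.
rewrite !(add_lfunE, scale_lfunE) !funE linearP !(add_lfunE, scale_lfunE).
by rewrite linearP opprD scalerN.
Qed.
HB.instance Definition _ :=
  GRing.isLinear.Build F L 'End(dual E) _ dual_rep_fun dual_rep_linear.

Fact dual_rep_br x y :
  linfun dual_rep_fun (lie_br x y)
  = opbr (linfun dual_rep_fun x) (linfun dual_rep_fun y).
Proof.
apply/lfunP => phi; apply/lfunP => e; rewrite opbrE.
have funE w psi u : linfun dual_rep_fun w psi u = - psi (A w u).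
  by rewrite lfunE /= lfunE /= opp_lfunE comp_lfunE.
rewrite add_lfunE opp_lfunE !funE rep_br opbrE linearB /=.
by rewrite opprB !opprK.
Qed.
Definition dual_rep : opRep L (dual E) := OpRep dual_rep_br.

Lemma dual_repE x phi e : dual_rep x phi e = - phi (A x e).
Proof. by rewrite lfunE /= lfunE /= opp_lfunE comp_lfunE. Qed.

(** The linear forms vanishing at [e] contain all the images of the dual
    representation and are not all forms, so the dual representation has a
    nonzero null vector. *)
Lemma conull_of_null e : lie_nilpotent L -> e != 0 -> (forall x, A x e = 0) ->
  exists2 phi : dual E, phi != 0 & forall x v, phi (A x v) = 0.
Proof.
move=> nilL e0 Ae0.
have [||W WP] := @vspace_of_pred _ _ (fun phi : dual E => phi e = 0).
- by rewrite zero_lfunE.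
- by move=> a u v ue0 ve0; rewrite add_lfunE scale_lfunE ue0 ve0 scaler0 addr0.
have [|||phi phi0 Aphi] := @null_vector_of_quotient _ _ _ dual_rep nilL fullv W.
- by move=> *; rewrite memvf.
- by move=> x phi _; apply/WP; rewrite dual_repE Ae0 linear0 oppr0.
- have [phi phie] := dual_separates e0; apply/subvPn; exists phi; rewrite ?memvf //.
  by apply: contra phie => /WP/eqP.
exists phi => // x v; apply/eqP; rewrite -oppr_eq0 -dual_repE Aphi.
by rewrite zero_lfunE.
Qed.

End Dual.

(** * Exterior multiplication and contraction on chains *)

Section Positions.
Variables (F : fieldType) (N : nat).
Implicit Types (i j : 'I_N) (T : {set 'I_N}).

Definition below i T := #|[set t in T | (t < i)%N]|.
(** The sign of moving the basis vector [b_i] to its place among those of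
    [T]. *)
Definition insert_sign i T : F := (-1) ^+ below i T.

Lemma insert_sign_setD1 i j T : j \in T ->
  insert_sign i T = (-1) ^+ (j < i)%N * insert_sign i (T :\ j).
Proof.
move=> jT; rewrite /insert_sign -exprD; congr (_ ^+ _).
rewrite /below (cardsD1 j) inE jT /=; congr (_ + _)%N.
by apply: eq_card => t; rewrite !inE andbA.
Qed.

Lemma insert_sign_setU1 i j T : j \notin T ->
  insert_sign i (j |: T) = (-1) ^+ (j < i)%N * insert_sign i T.
Proof.
by move=> jT; rewrite (@insert_sign_setD1 i j) ?finset.setU11 // finset.setU1K.
Qed.

Lemma insert_sign_sq i T : insert_sign i T * insert_sign i T = 1.
Proof. by rewrite -expr2 sqrr_sign. Qed.

(** This is the source of all the anticommutation relations below. *)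
Lemma sign_swap i j : i != j -> (-1) ^+ (i < j)%N = - (-1) ^+ (j < i)%N :> F.
Proof.
by rewrite -val_eqE; case: (ltngtP i j) => //= _ _; rewrite ?expr0 ?expr1 ?opprK.
Qed.

Lemma insert_sign_nth i0 T k : (k < #|T|)%N ->
  insert_sign (nth i0 (enum T) k) T = (-1) ^+ k.
Proof.
move=> ltkT; congr (_ ^+ _); set t := nth _ _ _.
have srt : sorted <%O%O (enum T).
  rewrite [enum _]/enum_mem; apply: sorted_filter; first exact: Order.POrderTheory.lt_trans.
  rewrite -enumT -[sorted _ _]/(sorted (relpre val ltn) _) -sorted_map val_enum_ord.
  exact: iota_ltn_sorted.
rewrite -(@Order.POrderTheory.count_lt_nth _ _ i0 (enum T) k srt) -?cardE // -/t.
rewrite -sum1_count big_enum_cond /=.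
by rewrite /below -sum1_card; apply: eq_bigl => s; rewrite inE.
Qed.

Lemma enum_setD1 i0 T k : (k < #|T|)%N ->
  enum (T :\ nth i0 (enum T) k) = take k (enum T) ++ drop k.+1 (enum T).
Proof.
move=> ltkT; set t := nth _ _ _.
have uT : uniq (enum T) by exact: enum_uniq.
have <- : index t (enum T) = k by rewrite index_uniq // -cardE.
rewrite -remE rem_filter // /enum_mem -filter_predI.
by apply: eq_filter => s; rewrite /= !inE.
Qed.

End Positions.

Section Exterior.
Variables (F : fieldType) (L : lieAlg F) (E : vectType F).
Local Notation N := (\dim {:L}).
Local Notation b := (vbasis {:L}).
Local Notation C := (chains L E).
Local Notation insert_sign := (insert_sign F).
Implicit Types (z u v : C) (i j : 'I_N) (S T : {set 'I_N}) (x y : L) (e : E).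

Lemma chainsD u v T : (u + v) T = u T + v T. Proof. exact: ffunE. Qed.
Lemma chainsN u T : (- u) T = - u T. Proof. exact: ffunE. Qed.
Lemma chainsZ a u T : (a *: u) T = a *: u T. Proof. exact: ffunE. Qed.
Lemma chains0 T : (0 : C) T = 0. Proof. exact: ffunE. Qed.
Lemma chains_sum (I : finType) (P : pred I) (G : I -> C) T :
  (\sum_(k | P k) G k) T = \sum_(k | P k) G k T.
Proof. by elim/big_rec2: _ => [|k y u _ <-]; rewrite ?chains0 ?chainsD. Qed.
Definition chainsE := (chainsD, chainsN, chainsZ, chains0).

(** Exterior multiplication by the basis vector [b_i]. *)
Definition insert i z : C :=
  [ffun T : {set 'I_N} => if i \in T then insert_sign i T *: z (T :\ i) else 0].
(** Contraction with the [i]-th vector of the dual basis. *)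
Definition contract i z : C :=
  [ffun T : {set 'I_N} => if i \in T then 0 else insert_sign i T *: z (i |: T)].

Lemma insertE i z T :
  insert i z T = if i \in T then insert_sign i T *: z (T :\ i) else 0.
Proof. exact: ffunE. Qed.
Lemma contractE i z T :
  contract i z T = if i \in T then 0 else insert_sign i T *: z (i |: T).
Proof. exact: ffunE. Qed.

Fact insert_linear i : linear (insert i).
Proof.
move=> a u v; apply/ffunP => T; rewrite !(chainsE, insertE); case: ifP => _.
  by rewrite scalerDr !scalerA mulrC.
by rewrite scaler0 addr0.
Qed.
HB.instance Definition _ i := GRing.isLinear.Build F C C _ (insert i) (insert_linear i).

Fact contract_linear i : linear (contract i).
Proof.
move=> a u v; apply/ffunP => T; rewrite !(chainsE, contractE); case: ifP => _.
  by rewrite scaler0 addr0.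
by rewrite scalerDr !scalerA mulrC.
Qed.
HB.instance Definition _ i := GRing.isLinear.Build F C C _ (contract i) (contract_linear i).

Lemma insert_insert i j z : insert i (insert j z) = - insert j (insert i z).
Proof.
apply/ffunP => T; rewrite chainsN !insertE.
have [<-|neij] := eqVneq i j.
  by rewrite !inE eqxx /= scaler0 if_same oppr0.
have neji : j != i by rewrite eq_sym.
rewrite !inE neij neji /=.
case: (boolP (i \in T)) => iT; case: (boolP (j \in T)) => jT;
  rewrite ?scaler0 ?oppr0 //.
have -> : T :\ i :\ j = T :\ j :\ i by apply/setP => t; rewrite !inE andbCA.
rewrite !scalerA -scaleNr; congr (_ *: _).
rewrite (@insert_sign_setD1 _ _ i j T) // (@insert_sign_setD1 _ _ j i T) //.
rewrite (sign_swap F neij).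
by rewrite !mulNr opprK -!mulrA [insert_sign i _ * _]mulrC.
Qed.

Lemma contract_insert i j z :
  contract j (insert i z) + insert i (contract j z) = (i == j)%:R *: z.
Proof.
apply/ffunP => T; rewrite !(chainsE, contractE, insertE) !inE.
have [<-|neij] := eqVneq i j.
  rewrite scale1r /=; case: (boolP (i \in T)) => iT.
    rewrite add0r scalerA finset.setD1K // (@insert_sign_setD1 _ _ i i) // ltnn mul1r.
    by rewrite insert_sign_sq scale1r.
  rewrite addr0 scalerA (@insert_sign_setU1 _ _ i i) // ltnn mul1r.
  by rewrite insert_sign_sq scale1r finset.setU1K.
rewrite scale0r /=.
case: (boolP (j \in T)) => jT; first by rewrite scaler0 if_same addr0.
case: (boolP (i \in T)) => iT; last by rewrite scaler0 addr0.
have -> : (j |: T) :\ i = j |: (T :\ i).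
  by apply/setP => t; rewrite !inE; case: (eqVneq t j) => // ->; rewrite eq_sym neij.
rewrite !scalerA -scalerDl (@insert_sign_setU1 _ _ i j) // (@insert_sign_setD1 _ _ j i) //.
rewrite (sign_swap F neij) mulrACA mulNr -expr2 sqrr_sign mulN1r [insert_sign i _ * _]mulrC.
by rewrite addNr scale0r.
Qed.

Definition wedge x z : C := \sum_i coord b i x *: insert i z.

Fact wedge_linear x : linear (wedge x).
Proof.
move=> a u v; rewrite /wedge scaler_sumr -big_split; apply: eq_bigr => i _.
by rewrite linearP scalerDr !scalerA mulrC.
Qed.
HB.instance Definition _ x := GRing.isLinear.Build F C C _ (wedge x) (wedge_linear x).

(** [wedge] with its arguments exchanged, to state linearity in the vector. *)
Definition wedgel z x := wedge x z.
Fact wedgel_linear z : linear (wedgel z).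
Proof.
move=> a x y; rewrite /wedgel /wedge scaler_sumr -big_split; apply: eq_bigr => i _.
by rewrite linearP scalerDl scalerA.
Qed.
HB.instance Definition _ z := GRing.isLinear.Build F L C _ (wedgel z) (wedgel_linear z).

Lemma wedge_anti x y z : wedge x (wedge y z) = - wedge y (wedge x z).
Proof.
rewrite {1}/wedge; under eq_bigr do rewrite /wedge linear_sum scaler_sumr.
rewrite exchange_big -sumrN; apply: eq_bigr => j _ /=.
rewrite linear_sum scaler_sumr -sumrN; apply: eq_bigr => i _.
by rewrite !linearZ /= insert_insert !scalerN !scalerA mulrC.
Qed.

Lemma contract_wedge j x z : contract j (wedge x z) = coord b j x *: z - wedge x (contract j z).
Proof.
rewrite linear_sum /wedge; apply/eqP; rewrite -subr_eq opprK -big_split /=.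
rewrite (bigD1 j) //= big1 => [|i neij]; rewrite linearZ -scalerDr contract_insert.
  by rewrite eqxx scale1r addr0.
by rewrite (negPf neij) scale0r scaler0.
Qed.

Definition chain_of e : C := [ffun T : {set 'I_N} => if T == finset.set0 then e else 0].
Lemma chain_ofE e T : chain_of e T = if T == finset.set0 then e else 0.
Proof. exact: ffunE. Qed.

Lemma ewedge_nil e : ewedge e [::] = chain_of e.
Proof.
by apply/ffunP => T; rewrite ffunE chain_ofE cards_eq0 det_mx00 scale1r.
Qed.

Lemma contract_chain_of j e : contract j (chain_of e) = 0.
Proof.
apply/ffunP => T; rewrite chains0 contractE chain_ofE.
case: ifP => // _; rewrite (negPf (_ : _ != _)) ?scaler0 //.
by apply/finset.set0Pn; exists j; rewrite finset.setU11.
Qed.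

(** Laplace expansion of the minors along their first row.  By this lemma
    exterior products of arbitrary vectors are iterated exterior
    multiplications. *)
Lemma ewedge_cons e x xs : ewedge e (x :: xs) = wedge x (ewedge e xs).
Proof.
apply/ffunP => T; rewrite ffunE chains_sum /=.
under eq_bigr => i _ do rewrite chainsZ insertE ffunE.
case: ifP => [/eqP cT|ncT]; last first.
  rewrite big1 // => i _; case: ifP => iT; last by rewrite scaler0.
  by move: ncT; rewrite (cardsD1 i) iT eqSS => ->; rewrite !scaler0.
have [i0 _] : exists i0, i0 \in T by apply/card_gt0P; rewrite cT.
rewrite [RHS](_ : _ =
    \sum_(i in T) coord b i x *: (insert_sign i T *: ewedge e xs (T :\ i))).
  rewrite -big_enum (big_nth i0) -cardE cT big_mkord.
  rewrite (expand_det_row _ ord0) scaler_suml; apply: eq_bigr => k _.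
  have ltkT : (k < #|T|)%N by rewrite cT.
  set t := nth i0 _ k.
  have tT : t \in T by rewrite -mem_enum mem_nth // -cardE.
  rewrite ffunE.
  have -> : (#|T :\ t| == size xs) by move/eqP: cT; rewrite (cardsD1 t) tT.
  rewrite !mxE (nth_map i0) -?cardE ?cT //= !scalerA.
  rewrite /cofactor add0n insert_sign_nth // mulrA; congr (_ * \det _ *: _).
  apply/matrixP => p q; rewrite !mxE /= enum_setD1 //.
  rewrite map_cat nth_cat size_map size_takel -?cardE ?(ltnW ltkT) //.
  rewrite map_take map_drop add0n /bump leqNgt.
  case: ltnP => leqk /=; rewrite ?nth_take ?nth_drop ?add0n //.
  by rewrite add1n addSn subnKC.
rewrite [RHS]big_mkcond /=; apply: eq_bigr => i _; case: ifP => _.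
  by rewrite ffunE.
by rewrite scaler0.
Qed.

Lemma chains_decomp z : z = \sum_S ewedge (z S) (basis_seq S).
Proof.
apply/ffunP => T; rewrite chains_sum (bigD1 T) //= ewedge_basis ffunE eqxx.
rewrite big1 ?addr0 // => S neST.
by rewrite ewedge_basis ffunE eq_sym (negPf neST).
Qed.

(** Two operators that agree in degree [0] and have the same commutation rule
    with exterior multiplications are equal: identities between operators
    are proved through this principle. *)
Lemma chains_ind (P : C -> Prop) :
    (forall u v, P u -> P v -> P (u + v)) -> (forall e, P (chain_of e)) ->
    (forall y z, P z -> P (wedge y z)) ->
  forall z, P z.
Proof.
move=> PD Pi Pw z; rewrite (chains_decomp z); apply: (big_rec P).
  by have := Pi 0; congr P; apply/ffunP => T; rewrite chain_ofE chains0 if_same.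
move=> S u _ Pu; apply: PD => //; elim: (basis_seq S) => [|x xs IH].
  by rewrite ewedge_nil.
by rewrite ewedge_cons; apply: Pw.
Qed.

Section Coef.
Variable a : 'End(E).
Definition map_coef z : C := [ffun T : {set 'I_N} => a (z T)].
Lemma map_coefE z T : map_coef z T = a (z T). Proof. exact: ffunE. Qed.
Fact map_coef_linear : linear map_coef.
Proof. by move=> c u v; apply/ffunP => T; rewrite !(chainsE, map_coefE) linearP. Qed.
HB.instance Definition _ := GRing.isLinear.Build F C C _ map_coef map_coef_linear.

Lemma map_coef_contract j z : map_coef (contract j z) = contract j (map_coef z).
Proof.
apply/ffunP => T; rewrite !(map_coefE, contractE); case: ifP => _; first exact: linear0.
by rewrite linearZ.
Qed.

Lemma map_coef_wedge x z : map_coef (wedge x z) = wedge x (map_coef z).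
Proof.
rewrite linear_sum; apply: eq_bigr => i _; rewrite linearZ /=; congr (_ *: _).
apply/ffunP => T; rewrite !(map_coefE, insertE); case: ifP => _; last exact: linear0.
by rewrite linearZ.
Qed.

Lemma map_coef_chain_of e : map_coef (chain_of e) = chain_of (a e).
Proof. by apply/ffunP => T; rewrite map_coefE !chain_ofE; case: ifP; rewrite ?linear0. Qed.
End Coef.

(** The extension of [ad x] to a derivation of the exterior algebra, in terms of
    a basis; see [ad_chain_wedge]. *)
Definition ad_chain x z : C := \sum_(j < N) wedge (lie_br x b`_j) (contract j z).

Fact ad_chain_linear x : linear (ad_chain x).
Proof.
move=> a u v; rewrite /ad_chain scaler_sumr -big_split; apply: eq_bigr => i _.
by rewrite !linearP.
Qed.
HB.instance Definition _ x := GRing.isLinear.Build F C C _ (ad_chain x) (ad_chain_linear x).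

Definition ad_chainl z x := ad_chain x z.
Fact ad_chainl_linear z : linear (ad_chainl z).
Proof.
move=> a x y; rewrite /ad_chainl /ad_chain scaler_sumr -big_split; apply: eq_bigr => i _ /=.
by rewrite lie_brDl -[LHS]/(wedgel _ _) linearP.
Qed.
HB.instance Definition _ z := GRing.isLinear.Build F L C _ (ad_chainl z) (ad_chainl_linear z).

Lemma ad_chain_chain_of x e : ad_chain x (chain_of e) = 0.
Proof. by rewrite /ad_chain big1 // => j _; rewrite contract_chain_of linear0. Qed.

Lemma ad_chain_wedge x y z :
  ad_chain x (wedge y z) = wedge (lie_br x y) z + wedge y (ad_chain x z).
Proof.
have -> : wedge (lie_br x y) z = \sum_j coord b j y *: wedge (lie_br x b`_j) z.
  rewrite {1}(coord_vbasis (memvf y)) linear_sum -[LHS]/(wedgel _ _) linear_sum.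
  by apply: eq_bigr => j _; rewrite !linearZ.
rewrite /ad_chain linear_sum -big_split; apply: eq_bigr => j _ /=.
by rewrite contract_wedge linearB /= wedge_anti opprK linearZ.
Qed.

Lemma map_coef_ad_chain a x z : map_coef a (ad_chain x z) = ad_chain x (map_coef a z).
Proof.
rewrite linear_sum; apply: eq_bigr => j _.
by rewrite /= map_coef_wedge map_coef_contract.
Qed.

Lemma ad_chain_ewedge x e xs :
  ad_chain x (ewedge e xs)
  = \sum_(l < size xs) (-1) ^+ l *: ewedge e (lie_br x xs`_l :: del l xs).
Proof.
elim: xs => [|y ys IH]; first by rewrite ewedge_nil ad_chain_chain_of big_ord0.
rewrite ewedge_cons ad_chain_wedge IH big_ord_recl scale1r {2}/del /= drop0 -ewedge_cons.
congr (_ + _); rewrite linear_sum; apply: eq_bigr => l _ /=.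
rewrite !ewedge_cons wedge_anti exprS mulN1r scaleNr scalerN opprK.
by rewrite linearZ /= wedge_anti linearN.
Qed.

(** A derivation extending a nilpotent map is nilpotent on each product of
    vectors, by [iter_commutator]. *)
Lemma ad_chain_nil x z : lie_nilpotent L -> exists M, iter M (ad_chain x) z = 0.
Proof.
case=> K lcsK; elim/chains_ind: z => [u v [M Mu] [M' Mv]|e|y z [M Mz]].
- exists (maxn M M'); rewrite iter_additiveD.
  by rewrite (iter_null_mono _ Mu) ?leq_maxl // (iter_null_mono _ Mv) ?leq_maxr // addr0.
- by exists 1%N; apply: ad_chain_chain_of.
exists (M + K)%N; pose h (k : nat) := iter k (lie_br x) y.
apply: (@iter_commutator _ (ad_chain x) (fun k : nat => wedge (h k)) K _ _ M z Mz) => [k v|v].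
  by rewrite /= ad_chain_wedge addrC.
have /eqP-> : h K == 0 by rewrite -memv0 -lcsK lcs_iter.
by rewrite -[LHS]/(wedgel _ _) linear0.
Qed.

Lemma degree_wedge p x z : in_degree p z -> in_degree p.+1 (wedge x z).
Proof.
move=> dz T cT; rewrite chains_sum big1 // => i _; rewrite chainsZ insertE.
case: ifP => iT; last by rewrite scaler0.
by rewrite dz ?scaler0 //; apply: contra cT; rewrite (cardsD1 i T) iT.
Qed.

Lemma degree_ad_chain p x z : in_degree p z -> in_degree p (ad_chain x z).
Proof.
move=> dz T cT; rewrite chains_sum big1 // => j _; rewrite chains_sum big1 // => i _.
rewrite chainsZ insertE; case: ifP => iT; last by rewrite scaler0.
rewrite contractE; case: ifP => jT; first by rewrite !scaler0.
by rewrite dz ?scaler0 //; apply: contra cT; rewrite cardsU1 jT (cardsD1 i T) iT.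
Qed.

Lemma degree_map_coef a p z : in_degree p z -> in_degree p (map_coef a z).
Proof. by move=> dz T cT; rewrite map_coefE dz // linear0. Qed.

Lemma ad_chain_br x y z :
  ad_chain (lie_br x y) z = ad_chain x (ad_chain y z) - ad_chain y (ad_chain x z).
Proof.
elim/chains_ind: z => [u v IHu IHv|e|w z IH].
- by rewrite !linearD /= IHu IHv addrACA -opprD.
- by rewrite !ad_chain_chain_of !linear0 addr0.
have cancel (P Q R S U V : C) :
    P - Q + (R - S) = P + U + (V + R) + (- (Q + V) - (U + S)).
  rewrite (addrACA P U) [RHS]addrACA; congr (_ + _).
    by rewrite opprD addrACA subrr addr0.
  by rewrite opprD addrACA subrr add0r.
rewrite !ad_chain_wedge !linearD /= !ad_chain_wedge IH lie_br_jacobi linearB /=.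
rewrite -[wedge (_ - _) z]/(wedgel z _) linearB /= /wedgel.
exact: cancel.
Qed.

Lemma degree_contract p j z : in_degree p z -> in_degree p.-1 (contract j z).
Proof.
move=> dz T cT; rewrite contractE; case: ifP => // jT.
by rewrite dz ?scaler0 //; apply: contra cT; rewrite cardsU1 jT => /eqP <-.
Qed.

Lemma degree_gt p z : (N < p)%N -> in_degree p z -> z = 0.
Proof.
move=> ltNp dz; apply/ffunP => T; rewrite chains0 dz //.
by apply: contraTneq ltNp => <-; rewrite -leqNgt -[X in (_ <= X)%N]card_ord max_card.
Qed.

Lemma wedge_vbasis j z : wedge b`_j z = insert j z.
Proof.
have free_b : free b by apply: basis_free (vbasisP _).
rewrite /wedge (bigD1 j) //= coord_free // eqxx scale1r big1 ?addr0 // => i neij.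
by rewrite coord_free // eq_sym (negPf neij) scale0r.
Qed.

Lemma wedge_set0 x z : wedge x z finset.set0 = 0.
Proof. by rewrite chains_sum big1 // => i _; rewrite chainsZ insertE inE scaler0. Qed.

(** If a monomial misses the index [j], multiplication by [b_j] does not lose
    its coefficient. *)
Lemma wedge_eq0_degree z : (forall x, wedge x z = 0) -> in_degree N z.
Proof.
move=> wz0 T cT; have [j jT] : exists j, j \notin T.
  apply/existsP; apply: contraNT cT; rewrite negb_exists => /forallP allT.
  rewrite -[X in _ == X]card_ord -cardsT; apply/eqP/eq_card => j.
  by rewrite inE; have := allT j; rewrite negbK.
have := congr1 (fun u : C => u (j |: T)) (wz0 b`_j).
rewrite wedge_vbasis insertE finset.setU11 finset.setU1K // chains0 => /eqP.
by rewrite scaler_eq0 signr_eq0 => /eqP.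
Qed.

End Exterior.

(** * The Koszul differential *)

Section Differential.
Variables (F : fieldType) (L : lieAlg F) (E : vectType F) (A : opRep L E).
Local Notation N := (\dim {:L}).
Local Notation b := (vbasis {:L}).
Local Notation C := (chains L E).
Implicit Types (z u v : C) (x y : L) (e : E).

Lemma map_coef_sum x z : map_coef (A x) z = \sum_j coord b j x *: map_coef (A b`_j) z.
Proof.
apply/ffunP => T; rewrite map_coefE chains_sum {1}(coord_vbasis (memvf x)).
rewrite linear_sum sum_lfunE; apply: eq_bigr => j _.
by rewrite linearZ chainsZ map_coefE /= scale_lfunE.
Qed.

(** The Lie derivative of chains along [x]. *)
Definition lie_deriv x z : C := map_coef (A x) z - ad_chain x z.

Fact lie_deriv_linear x : linear (lie_deriv x).
Proof. by move=> a u v; rewrite /lie_deriv !linearP /= scalerDr addrACA. Qed.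
HB.instance Definition _ x := GRing.isLinear.Build F C C _ (lie_deriv x) (lie_deriv_linear x).

Lemma lie_deriv_linearl a x y z :
  lie_deriv (a *: x + y) z = a *: lie_deriv x z + lie_deriv y z.
Proof.
have ad_chainP : ad_chain (a *: x + y) z = a *: ad_chain x z + ad_chain y z.
  by rewrite -[LHS]/(ad_chainl z _) linearP.
rewrite /lie_deriv ad_chainP opprD scalerBr [RHS]addrACA; congr (_ + _).
by apply/ffunP => T; rewrite chainsD chainsZ !map_coefE linearP add_lfunE scale_lfunE.
Qed.

Lemma lie_deriv_wedge x y z :
  lie_deriv x (wedge y z) = wedge y (lie_deriv x z) - wedge (lie_br x y) z.
Proof.
by rewrite /lie_deriv map_coef_wedge ad_chain_wedge linearB /= opprD addrA addrAC.
Qed.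

Lemma lie_deriv_br x y z :
  lie_deriv (lie_br x y) z = lie_deriv y (lie_deriv x z) - lie_deriv x (lie_deriv y z).
Proof.
rewrite {1}/lie_deriv ad_chain_br.
have -> : map_coef (A (lie_br x y)) z =
    map_coef (A y) (map_coef (A x) z) - map_coef (A x) (map_coef (A y) z).
  by apply/ffunP => T; rewrite !(chainsE, map_coefE) rep_br opbrE.
rewrite /lie_deriv (linearB (map_coef (A y))) (linearB (map_coef (A x))).
rewrite (linearB (ad_chain y)) (linearB (ad_chain x)) /= !map_coef_ad_chain.
by rewrite cross_terms_cancel.
Qed.

Definition lie_deriv_op x : 'End(C) := linfun (lie_deriv x).
Fact lie_deriv_op_linear : linear lie_deriv_op.
Proof.
move=> a x y; apply/lfunP => z; rewrite add_lfunE scale_lfunE !lfunE.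
exact: lie_deriv_linearl.
Qed.
HB.instance Definition _ := GRing.isLinear.Build F L 'End(C) _ lie_deriv_op lie_deriv_op_linear.

Lemma lie_deriv_repE x z : linfun lie_deriv_op x z = lie_deriv x z.
Proof. by rewrite lfunE /= lfunE. Qed.

Fact lie_deriv_rep_br x y :
  linfun lie_deriv_op (lie_br x y) = opbr (linfun lie_deriv_op x) (linfun lie_deriv_op y).
Proof. by apply/lfunP => z; rewrite opbrE !lie_deriv_repE lie_deriv_br. Qed.

Definition lie_deriv_rep : opRep L C := OpRep lie_deriv_rep_br.

(** A formula for the differential that does not refer to the order of the
    factors of a monomial.  The second sum runs over ordered pairs of indices and
    so counts every bracket twice, whence the factor [1/2]. *)
Definition koszul z : C :=
  \sum_(j < N) map_coef (A b`_j) (contract j z)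
  - 2%:R^-1 *: \sum_(j < N) ad_chain b`_j (contract j z).

Fact koszul_linear : linear koszul.
Proof.
move=> a u v; rewrite /koszul.
rewrite (eq_bigr (fun j : 'I_N => a *: map_coef (A b`_j) (contract j u)
                                    + map_coef (A b`_j) (contract j v))).
  rewrite [X in _ - _ *: X](eq_bigr (fun j : 'I_N => a *: ad_chain b`_j (contract j u)
                                    + ad_chain b`_j (contract j v))).
    rewrite !big_split /= -!scaler_sumr scalerDr opprD scalerBr [RHS]addrACA.
    by rewrite scalerA mulrC -scalerA.
  by move=> j _; rewrite !linearP.
by move=> j _; rewrite !linearP.
Qed.
HB.instance Definition _ := GRing.isLinear.Build F C C _ koszul koszul_linear.

Lemma koszul_chain_of e : koszul (chain_of L e) = 0.
Proof.
by rewrite /koszul !big1 ?scaler0 ?subr0 // => j _; rewrite contract_chain_of linear0.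
Qed.

Lemma degree_koszul p z : in_degree p z -> in_degree p.-1 (koszul z).
Proof.
move=> dz T cT; rewrite chainsD chainsN chainsZ !chains_sum.
rewrite !big1 ?scaler0 ?subr0 // => j _.
  exact: (degree_ad_chain _ (degree_contract _ dz) cT).
exact: (degree_map_coef _ (degree_contract _ dz) cT).
Qed.

Hypothesis two_neq0 : 2%:R != 0 :> F.

(** Cartan's formula.  Moving the contractions past [wedge x] produces
    [A x] from the first sum of [koszul], and twice [ad_chain x] from the second
    one: once from [contract_wedge] and once from [ad_chain_wedge]. *)
Lemma koszul_wedge x z : koszul (wedge x z) = lie_deriv x z - wedge x (koszul z).
Proof.
rewrite /koszul.
have -> : \sum_(j < N) map_coef (A b`_j) (contract j (wedge x z))
    = map_coef (A x) z - wedge x (\sum_(j < N) map_coef (A b`_j) (contract j z)).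
  rewrite map_coef_sum (linear_sum (wedge x)) -sumrB; apply: eq_bigr => j _ /=.
  by rewrite contract_wedge linearB /= linearZ map_coef_wedge.
have -> : \sum_(j < N) ad_chain b`_j (contract j (wedge x z))
    = (ad_chain x z) *+ 2 - wedge x (\sum_(j < N) ad_chain b`_j (contract j z)).
  have xz : ad_chain x z = \sum_j coord b j x *: ad_chain b`_j z.
    rewrite -[LHS]/(ad_chainl z _) {1}(coord_vbasis (memvf x)) linear_sum.
    by apply: eq_bigr => j _; rewrite linearZ.
  rewrite mulr2n {1}xz [ad_chain x z]/ad_chain -big_split (linear_sum (wedge x)) -sumrB.
  apply: eq_bigr => j _ /=.
  rewrite contract_wedge linearB linearZ /= ad_chain_wedge opprD addrA.
  by congr (_ + _ - _); rewrite lie_brN -[wedge (- _) _]/(wedgel _ _) linearN opprK.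
rewrite scalerBr -scaler_nat scalerA mulVf // scale1r (linearB (wedge x)) /=.
by rewrite /lie_deriv !opprD !opprK [LHS]addrACA linearZ.
Qed.

(** A formal consequence of Cartan's formula and of [lie_deriv_br]. *)
Lemma koszul_lie_deriv x z : koszul (lie_deriv x z) = lie_deriv x (koszul z).
Proof.
elim/chains_ind: z => [u v IHu IHv|e|y z IH].
- rewrite (linearD (lie_deriv x)) (linearD koszul (lie_deriv x u)).
  by rewrite (linearD koszul u) (linearD (lie_deriv x)) /= IHu IHv.
- rewrite koszul_chain_of linear0 /lie_deriv ad_chain_chain_of.
  by rewrite subr0 map_coef_chain_of koszul_chain_of.
rewrite lie_deriv_wedge (linearB koszul (wedge y (lie_deriv x z))) /= !koszul_wedge IH.
rewrite (linearB (lie_deriv x) (lie_deriv y z)) /=.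
rewrite lie_deriv_wedge lie_deriv_br.
have cancel (P Q R S : C) : P - R - (P - Q - S) = Q - (R - S).
  rewrite !opprB [LHS]addrC (addrA S) (addrA (S + Q - P)).
  by rewrite subrK addrA [S + Q]addrC.
exact: cancel.
Qed.

Hypothesis nilL : lie_nilpotent L.

(** By Cartan's formula the Lie derivative of a cycle [u] along [x] is the
    boundary of [wedge x u], so a cycle that is not a boundary shows that the
    space [U] of cycles is not spanned by its Lie derivatives. *)
Lemma null_vector_of_homology p z :
    in_degree p z -> koszul z = 0 -> (forall w, in_degree p.+1 w -> koszul w != z) ->
  exists2 e, e != 0 & forall x, A x e = 0.
Proof.
move=> dz Dz0 nbz.
have [||U UP] := @vspace_of_pred _ _ (fun u : C => in_degree p u /\ koszul u = 0).
- by split; [move=> T _; exact: chains0 | exact: linear0].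
- move=> a u v [du Du] [dv Dv]; rewrite (linearP koszul a u v) /= Du Dv scaler0.
  rewrite addr0; split=> //.
  by move=> T cT; rewrite !chainsE du ?dv // scaler0 addr0.
have [||W WP] := @vspace_of_pred _ _
  (fun u : C => exists2 w, in_degree p.+1 w & koszul w = u).
- by exists 0; [move=> T _; exact: chains0 | exact: linear0].
- move=> a _ _ [u du <-] [v dv <-]; exists (a *: u + v); last exact: (linearP koszul).
  by move=> T cT; rewrite !chainsE du ?dv // scaler0 addr0.
have [|x u /UP[du Du0]||v v0 thv] :=
    @null_vector_of_quotient _ _ _ lie_deriv_rep nilL U W.
- move=> x u /UP[du Du0]; rewrite /= lie_deriv_repE; apply/UP; split.
    move=> T cT; rewrite chainsD chainsN (degree_map_coef _ du cT).
    by rewrite (degree_ad_chain _ du cT) subr0.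
  by rewrite koszul_lie_deriv Du0 linear0.
- apply/WP; exists (wedge x u); first exact: degree_wedge.
  by rewrite koszul_wedge Du0 linear0 subr0 /= lie_deriv_repE.
- apply/subvPn; exists z; first by apply/UP.
  by apply/negP => /WP[w dw Dw]; have := nbz w dw; rewrite Dw eqxx.
have map_coef_ad_chain_v x M : iter M (map_coef (A x)) v = iter M (ad_chain x) v.
  elim: M => //= M ->.
  have av : map_coef (A x) v = ad_chain x v.
    by apply/eqP; rewrite -subr_eq0 -[_ - _]/(lie_deriv x v) -lie_deriv_repE thv.
  elim: M => //= M IH; by rewrite map_coef_ad_chain IH.
have [T vT0] : exists T, v T != 0.
  apply/existsP; apply: contraNT v0; rewrite negb_exists => /forallP v0.
  by apply/eqP/ffunP => T; rewrite chains0; have := v0 T; rewrite negbK => /eqP.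
have [||K KP] := @vspace_of_pred _ _ (fun e => forall x, gen_null A x e).
- by move=> x; exists 0%N.
- by move=> a e e' ne ne' x; apply: gen_null_linear.
apply: (engel (A := A) nilL (U := K)).
- by move=> y e /KP ne; apply/KP => x; apply: gen_null_stable.
- apply/eqP => K0; case/negP: vT0; rewrite -memv0 -K0; apply/KP => x.
  have [M Mv] := ad_chain_nil x v nilL; exists M.
  rewrite -[RHS](chains0 E T) -Mv -map_coef_ad_chain_v; elim: (M) => //= n ->.
  by rewrite map_coefE.
- by move=> x e /KP.
Qed.

(** The boundaries in degree [0] are the sums of images of the [A x]: the terms
    with a bracket are exterior multiples of that bracket, so they have no
    component in degree [0]. *)
Lemma bottom_cycle_not_boundary e (phi : dual E) w :
  (forall x e', phi (A x e') = 0) -> phi e != 0 -> koszul w != chain_of L e.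
Proof.
move=> phiA; apply: contraNneq => /(congr1 (fun z : C => phi (z finset.set0))).
rewrite chain_ofE eqxx => <-; rewrite chainsD chainsN chainsZ !chains_sum.
rewrite [X in _ - _ *: X]big1 => [|j _]; last first.
  by rewrite chains_sum big1 // => i _; rewrite wedge_set0.
rewrite scaler0 subr0 linear_sum big1 // => j _.
by rewrite map_coefE; apply: phiA.
Qed.

(** The chain [e (x) b_0 /\ ... /\ b_(N-1)]. *)
Definition top_chain e : C := [ffun T : {set 'I_N} => if T == [set: 'I_N] then e else 0].

Lemma degree_top_chain e : in_degree N (top_chain e).
Proof.
move=> T; rewrite ffunE; case: (eqVneq T _) => [->|] //.
by rewrite cardsT card_ord eqxx.
Qed.

(** [ad_chain x] multiplies a chain of top degree by a scalar, the trace of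
    [ad x], and it is nilpotent, so the scalar is [0]. *)
Lemma ad_chain_top_chain x e : ad_chain x (top_chain e) = 0.
Proof.
have [->|e0] := eqVneq e 0.
  have -> : top_chain 0 = 0 by apply/ffunP => T; rewrite ffunE chains0 if_same.
  exact: linear0.
have [c cE] : exists c, ad_chain x (top_chain e) = c *: top_chain e.
  (* The derivation commutes with maps of the coefficients, hence preserves the
     chains with coefficients in the line of [e]. *)
  pose a := projv <[e]>%VS.
  have ae : map_coef a (top_chain e) = top_chain e.
    apply/ffunP => T; rewrite map_coefE ffunE; case: ifP => _; last exact: linear0.
    by rewrite projv_id ?memv_line.
  have /vlineP[c cE] : ad_chain x (top_chain e) [set: 'I_N] \in <[e]>%VS.
    by rewrite -ae -map_coef_ad_chain map_coefE memv_proj.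
  exists c; apply/ffunP => T; rewrite chainsZ ffunE; case: eqP => [->|/eqP neT] //.
  rewrite scaler0; apply: (degree_ad_chain x (@degree_top_chain e)).
  by apply: contra neT => cT; rewrite eqEcard finset.subsetT cardsT card_ord (eqP cT) /=.
have [M] := ad_chain_nil x (top_chain e) nilL.
have -> : iter M (ad_chain x) (top_chain e) = c ^+ M *: top_chain e.
  elim: M => [|M IH] /=; first by rewrite scale1r.
  by rewrite IH linearZ /= cE scalerA exprSr.
move/(congr1 (fun z : C => z [set: 'I_N])); rewrite chainsZ ffunE eqxx chains0.
move/eqP; rewrite scaler_eq0 (negPf e0) orbF expf_eq0 => /andP[_ /eqP c0].
by rewrite cE c0 scale0r.
Qed.

(** The chain is killed by the Lie derivatives and, for reasons of degree, by
    exterior multiplications.  Cartan's formula then shows that exterior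
    multiplications kill its differential too, which forces this differential
    into the top degree, whereas it lives one degree below. *)
Lemma koszul_top_chain e : (forall x, A x e = 0) -> koszul (top_chain e) = 0.
Proof.
move=> Ae0; have dtop := @degree_top_chain e.
have th0 x : lie_deriv x (top_chain e) = 0.
  rewrite /lie_deriv ad_chain_top_chain subr0; apply/ffunP => T.
  by rewrite map_coefE ffunE chains0; case: ifP => _; rewrite ?Ae0 ?linear0.
have dD : in_degree N (koszul (top_chain e)).
  apply: wedge_eq0_degree => x; apply/eqP; rewrite -oppr_eq0 -[- _]add0r.
  rewrite -{1}(th0 x) -koszul_wedge (degree_gt _ (degree_wedge x dtop)) //.
  by rewrite linear0.
(* The degree [N.-1] differs from [N] only when [L] is nonzero. *)
case: (posnP N) => [N0|Npos].
  have -> : top_chain e = chain_of L e; last exact: koszul_chain_of.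
  apply/ffunP => T; rewrite ffunE chain_ofE.
  suff -> : [set: 'I_N] = finset.set0 by [].
  by apply/eqP; rewrite -cards_eq0 cardsT card_ord N0.
apply/ffunP => T; rewrite chains0; have [cT|] := eqVneq #|T| N; last exact: dD.
by apply: (degree_koszul dtop); rewrite cT -{1}(prednK Npos) neq_ltn ltnSn orbT.
Qed.

End Differential.

Section Shift.
Variables (F : fieldType) (L : lieAlg F) (E : vectType F).
Variables (rho : opRep L E) (f : dual L) (char_f : lie_character f).
Local Notation b := (vbasis {:L}).
Local Notation C := (chains L E).

Definition shift_op (x : L) : 'End(E) := rho x - (f x : F) *: \1%VF.

Fact shift_op_linear : linear shift_op.
Proof.
move=> a x y; rewrite /shift_op !linearP /= scalerDl opprD scalerBr addrACA.
by rewrite scalerA.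
Qed.
HB.instance Definition _ := GRing.isLinear.Build F L 'End(E) _ shift_op shift_op_linear.

Lemma shift_opE x e : linfun shift_op x e = rho x e - (f x : F) *: e.
Proof. by rewrite lfunE /= add_lfunE opp_lfunE scale_lfunE id_lfunE. Qed.

Fact shift_br x y :
  linfun shift_op (lie_br x y) = opbr (linfun shift_op x) (linfun shift_op y).
Proof.
apply/lfunP => e; rewrite opbrE !shift_opE char_f scale0r subr0 rep_br opbrE.
rewrite !(linearB (rho _)) !(linearZ_LR (rho _)) /= !scalerBr cross_terms_cancel.
by rewrite !scalerA mulrC subrr subr0.
Qed.

(** [rho - f]; it is a representation since [f] is a character. *)
Definition shift_rep : opRep L E := OpRep shift_br.

Lemma shift_repE x e : shift_rep x e = rho x e - (f x : F) *: e.
Proof. exact: shift_opE. Qed.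

Hypothesis two_neq0 : 2%:R != 0 :> F.

(** On a product [x :: xs], the term of [dwedge] that removes [x] and those that
    pair [x] with a later factor form the Lie derivative of the product of [xs];
    the other terms are those for [xs], multiplied by [x] with one more
    transposition.  This is the recursion given by Cartan's formula. *)
Lemma koszul_ewedge e xs : koszul shift_rep (ewedge e xs) = dwedge rho f e xs.
Proof.
have ewK (y x : L) ys e' : ewedge e' (y :: x :: ys) = - wedge x (ewedge e' (y :: ys)) :> C.
  by rewrite !ewedge_cons wedge_anti.
elim: xs => [|x xs IH].
  by rewrite ewedge_nil koszul_chain_of /dwedge !big_ord0 addr0.
rewrite ewedge_cons koszul_wedge // IH /dwedge.
rewrite [in RHS]big_ord_recl /= scale1r {4}/del /= drop0.
(* [D1] and [D2] are the two parts of [dwedge] for [xs]. *)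
set D1 := \sum_(k < _) _; set D2 := \sum_(k < _) _.
rewrite [X in _ = _ + X + _](_ : _ = - wedge x D1); last first.
  rewrite (linear_sum (wedge x)) -sumrN; apply: eq_bigr => k _ /=.
  by rewrite (linearZ_LR (wedge x)) /= -ewedge_cons exprS mulN1r scaleNr.
rewrite [X in _ = _ + X](_ : _ = - ad_chain x (ewedge e xs) - wedge x D2); last first.
  rewrite big_ord_recl; congr (_ + _).
    rewrite ad_chain_ewedge -sumrN big_mkcond big_ord_recl /= add0r.
    apply: eq_bigr => l _; rewrite /= exprS mulN1r scaleNr.
    by rewrite {1}/del /= drop0.
  rewrite (linear_sum (wedge x)) -sumrN; apply: eq_bigr => k _ /=.
  rewrite big_mkcond big_ord_recl /= add0r -big_mkcond.
  rewrite (linear_sum (wedge x)) -sumrN; apply: eq_bigr => l _ /=.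
  rewrite linearZ /= -scalerN -ewK.
  by rewrite !/bump /= !add1n addnS addSn exprS mulN1r exprS mulN1r opprK.
rewrite /lie_deriv.
have -> : map_coef (shift_rep x) (ewedge e xs) = ewedge (rho x e - (f x : F) *: e) xs.
  apply/ffunP => T; rewrite map_coefE !ffunE; case: ifP => _; last exact: linear0.
  by rewrite linearZ /= shift_opE.
by rewrite linearD opprD -!addrA; congr (_ + _); rewrite addrCA.
Qed.

Lemma dkoszulE z : dkoszul rho f z = koszul shift_rep z.
Proof.
rewrite [in RHS](chains_decomp z) linear_sum; apply: eq_bigr => S _.
by rewrite /= koszul_ewedge.
Qed.

End Shift.

Local Open Scope classical_set_scope.

(** * Spectra and weights *)

Section Spectrum.
Variables (F : fieldType) (L : lieAlg F) (E : vectType F) (rho : opRep L E).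
Hypotheses (two_neq0 : 2%:R != 0 :> F) (nilL : lie_nilpotent L).

Definition weights : set (dual L) :=
  [set f | lie_character f /\
           exists2 e, e != 0 & forall x, rho x e = (f x : F) *: e].

Lemma shift_rep_null f (char_f : lie_character f) x e :
  (shift_rep rho char_f x e == 0) = (rho x e == (f x : F) *: e).
Proof. by rewrite shift_repE subr_eq0. Qed.

Lemma homology_weight f p :
  lie_character f -> homology_neq0 rho f p -> weights f.
Proof.
move=> char_f [z [dz]]; rewrite (dkoszulE _ char_f) // => Dz0 nbz.
split=> //; have [|e e0 Ae] := null_vector_of_homology two_neq0 nilL dz Dz0.
  move=> w dw; apply/eqP => Dw; apply: nbz; exists w => //.
  by rewrite (dkoszulE _ char_f).
by exists e => // x; apply/eqP; rewrite -shift_rep_null Ae.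
Qed.

Lemma weight_homology_bottom f : weights f -> homology_neq0 rho f 0.
Proof.
case=> char_f [e e0 fe].
have Ae x : shift_rep rho char_f x e = 0 by apply/eqP; rewrite shift_rep_null fe.
have [phi phi0 phiA] := conull_of_null nilL e0 Ae.
have [e' phie'] : exists e', phi e' != 0.
  apply: contrapT => /forallNP phi_null; case/eqP: phi0; apply/lfunP => v.
  by rewrite zero_lfunE; apply/eqP/negPn/negP; exact: phi_null.
exists (chain_of L e'); first split.
- by move=> T; rewrite cards_eq0 chain_ofE => /negPf->.
- by rewrite (dkoszulE _ char_f) // koszul_chain_of.
case=> w _; rewrite (dkoszulE _ char_f) //; apply/eqP.
exact: bottom_cycle_not_boundary phiA phie'.
Qed.

Lemma weight_homology_top f : weights f -> homology_neq0 rho f (\dim {:L}).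
Proof.
case=> char_f [e e0 fe].
have Ae x : shift_rep rho char_f x e = 0 by apply/eqP; rewrite shift_rep_null fe.
exists (top_chain L e); first split.
- exact: degree_top_chain.
- by rewrite (dkoszulE _ char_f) // koszul_top_chain.
case=> w /(degree_gt (ltnSn _))->; rewrite (dkoszulE _ char_f) // linear0.
move/(congr1 (fun z : chains L E => z [set: _]%SET)).
by rewrite chains0 ffunE eqxx => /esym/eqP; rewrite (negPf e0).
Qed.

Lemma Sp_weights : Sp rho = weights.
Proof.
apply/seteqP; split=> f; first by case=> char_f [p]; apply: homology_weight.
by move=> wf; split; [case: wf | exists 0%N; apply: weight_homology_bottom].
Qed.

Lemma sigma_delta_weights k : sigma_delta rho k = weights.
Proof.
apply/seteqP; split=> f; first by case=> p _ []; apply: homology_weight.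
by move=> wf; exists 0%N; split; [case: wf | apply: weight_homology_bottom].
Qed.

Lemma sigma_pi_weights k : (k <= \dim {:L})%N -> sigma_pi rho k = weights.
Proof.
move=> lekN; apply/seteqP; split=> f; first by case=> p _ []; apply: homology_weight.
move=> wf; exists (\dim {:L}); first by rewrite /= lekN leqnn.
by split; [case: wf | apply: weight_homology_top].
Qed.

End Spectrum.

Lemma dim_lie_of_sub (F : fieldType) (E : vectType F) (L : lieSubalg E) :
  \dim {:lie_of_sub L} = \dim L.
Proof. by rewrite dimvf. Qed.

(** * Weights of tensor products *)

Section Product.
Variables (F : fieldType) (L1 L2 : lieAlg F).

Lemma dim_lie_prod : \dim {:lie_prod L1 L2} = (\dim {:L1} + \dim {:L2})%N.
Proof. by rewrite !dimvf. Qed.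

Lemma lcs_lie_prod n (v : lie_prod L1 L2) : v \in lie_lcs (lie_prod L1 L2) n ->
  v.1 \in lie_lcs L1 n /\ v.2 \in lie_lcs L2 n.
Proof.
elim: n v => [|n IH] v; first by rewrite !memvf.
have [||W WP] := @vspace_of_pred _ (lie_prod L1 L2)
  (fun v => v.1 \in lie_lcs L1 n.+1 /\ v.2 \in lie_lcs L2 n.+1).
- by rewrite !mem0v.
- by move=> a u w [u1 u2] [w1 w2]; split; apply: memvD; rewrite ?memvZ.
move=> vlcs; apply/WP; apply: subvP vlcs; apply: lcs_least => x y /IH[y1 y2].
by apply/WP; split; apply: lcs_lie_br.
Qed.

Lemma nilpotent_lie_prod :
  lie_nilpotent L1 -> lie_nilpotent L2 -> lie_nilpotent (lie_prod L1 L2).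
Proof.
move=> [n1 lcs1] [n2 lcs2]; exists (maxn n1 n2); apply/eqP; rewrite -subv0.
apply/subvP => -[x y] /lcs_lie_prod[/=].
rewrite (lcs_eq0_mono (leq_maxl _ _) lcs1) (lcs_eq0_mono (leq_maxr _ _) lcs2).
by rewrite !memv0 => /eqP-> /eqP->.
Qed.

Definition inl_lie (x : L1) : lie_prod L1 L2 := (x, 0 : L2).
Definition inr_lie (y : L2) : lie_prod L1 L2 := (0 : L1, y).

Fact inl_lie_linear : linear inl_lie.
Proof. by move=> c x y; congr (_, _); rewrite /= scaler0 addr0. Qed.
HB.instance Definition _ :=
  GRing.isLinear.Build F L1 (lie_prod L1 L2) _ inl_lie inl_lie_linear.

Fact inr_lie_linear : linear inr_lie.
Proof. by move=> c x y; congr (_, _); rewrite /= scaler0 addr0. Qed.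
HB.instance Definition _ :=
  GRing.isLinear.Build F L2 (lie_prod L1 L2) _ inr_lie inr_lie_linear.

Lemma dual_pair_inl (a : dual L1) (b : dual L2) x : dual_pair a b (inl_lie x) = a x.
Proof. by rewrite dual_pairE /= linear0 addr0. Qed.

Lemma dual_pair_inr (a : dual L1) (b : dual L2) y : dual_pair a b (inr_lie y) = b y.
Proof. by rewrite dual_pairE /= linear0 add0r. Qed.

Lemma dual_pair_split (f : dual (lie_prod L1 L2)) :
  exists (a : dual L1) (b : dual L2), f = dual_pair a b.
Proof.
exists (f \o linfun inl_lie)%VF, (f \o linfun inr_lie)%VF; apply/lfunP => -[x y].
rewrite dual_pairE !comp_lfunE !lfunE /= -linearD; congr (f _).
by congr (_, _); rewrite /= ?addr0 ?add0r.
Qed.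

Lemma character_dual_pair (a : dual L1) (b : dual L2) :
  lie_character (dual_pair a b : dual (lie_prod L1 L2))
  <-> lie_character a /\ lie_character b.
Proof.
split=> [char_ab|[char_a char_b] u v]; last first.
  by rewrite dual_pairE /= char_a char_b addr0.
split=> x y.
  rewrite -(dual_pair_inl a b) -[RHS](char_ab (inl_lie x) (inl_lie y)).
  by congr (dual_pair _ _ _); congr (_, _); rewrite /= linear0.
rewrite -(dual_pair_inr a b) -[RHS](char_ab (inr_lie x) (inr_lie y)).
by congr (dual_pair _ _ _); congr (_, _); rewrite /= linear0.
Qed.

End Product.

(** Biduality in finite dimension. *)
Lemma dual_eval (F : fieldType) (E : vectType F) (Psi : 'Hom(dual E, F^o)) :
  exists e, forall phi : dual E, phi e = Psi phi.
Proof.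
pose b := vbasis {:E}; pose c i : dual E := linfun (coord b i : E -> F^o).
exists (\sum_(i < \dim {:E}) Psi (c i) *: b`_i) => phi.
have {2}-> : phi = \sum_(i < \dim {:E}) phi b`_i *: c i.
  apply/lfunP => v; rewrite sum_lfunE {1}(coord_vbasis (memvf v)) linear_sum.
  apply: eq_bigr => i _.
  by rewrite linearZ /= scale_lfunE lfunE /=; exact: mulrC.
rewrite !linear_sum; apply: eq_bigr => i _; rewrite !linearZ /=.
exact: mulrC.
Qed.

Section Tensor.
Variables (F : fieldType) (E1 E2 : vectType F).
Variables (L1 : lieSubalg E1) (L2 : lieSubalg E2).

Lemma rep_inclE (E : vectType F) (L : lieSubalg E) (x : lie_of_sub L) :
  rep_incl L x = vsval x.
Proof. by rewrite lfunE. Qed.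

Lemma rep_tens_apply (x : lie_of_sub L1) (y : lie_of_sub L2)
    (T : tensor E1 E2) (phi : dual E1) :
  rep_tens L1 L2 (x, y) T phi
  = T (phi \o rep_incl L1 x)%VF + rep_incl L2 y (T phi).
Proof.
have opE u v : tens_op u v T phi = v (T (phi \o u)%VF).
  by rewrite lfunE /= tens_op_funE.
by rewrite rep_tensE !rep_inclE !add_lfunE !opE !id_lfunE comp_lfun1r.
Qed.

(** A simultaneous eigenvector [T] of the tensor product is a nonzero map from
    the dual of [E1] to [E2].  Each nonzero value [T phi] is an eigenvector of
    [L2].  Composing [T] with a linear form that does not vanish at [T phi] gives an
    element of the bidual of [E1], that is a vector [e], and it is an eigenvector
    of [L1]. *)
Lemma weights_tensor :
  weights (rep_tens L1 L2)
  = [set dual_pair a b | a in weights (rep_incl L1) & b in weights (rep_incl L2)].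
Proof.
apply/seteqP; split=> [f|_ [a [chara [e1 e10 ae1]] [b [charb [e2 e20 be2]] <-]]].
  have [a [b ->]] := dual_pair_split f.
  case=> /character_dual_pair[char_a char_b] [T T0 abT].
  have Tl x phi : T (phi \o rep_incl L1 x)%VF = (a x : F) *: T phi.
    have := congr1 (fun S : tensor E1 E2 => S phi) (abT (inl_lie _ x)).
    by rewrite rep_tens_apply dual_pair_inl scale_lfunE linear0 zero_lfunE addr0.
  have Tr y phi : rep_incl L2 y (T phi) = (b y : F) *: T phi.
    have := congr1 (fun S : tensor E1 E2 => S phi) (abT (inr_lie _ y)).
    rewrite rep_tens_apply dual_pair_inr scale_lfunE linear0.
    by rewrite comp_lfun0r linear0 add0r.
  have [phi Tphi0] : exists phi, T phi != 0.
    apply: contrapT => /forallNP T_null; case/eqP: T0; apply/lfunP => phi.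
    by rewrite zero_lfunE; apply/eqP/negPn/negP; exact: T_null.
  exists a; last exists b => //; split=> //; last by exists (T phi).
  have [psi psiT] := dual_separates Tphi0.
  have [e eP] := dual_eval (psi \o T)%VF.
  exists e; first by apply: contraNneq psiT => e0; rewrite -comp_lfunE -eP e0 linear0.
  move=> x; apply/eqP; rewrite -subr_eq0; apply: contrapT => /negP.
  case/dual_separates => chi; rewrite linearB linearZ /= -comp_lfunE !eP.
  by rewrite !comp_lfunE Tl linearZ subrr eqxx.
split; first exact/character_dual_pair.
exists (tens e1 e2).
  have [phi phie1] := dual_separates e10.
  apply: contra_neq e20 => /(congr1 (fun T : tensor E1 E2 => T phi)).
  rewrite tensE zero_lfunE => /eqP; rewrite scaler_eq0 (negPf phie1).
  by move/eqP.
move=> [x y]; rewrite dual_pairE /=; apply/lfunP => phi.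
rewrite rep_tens_apply scale_lfunE !tensE comp_lfunE ae1 (linearZ_LR phi) /=.
rewrite linearZ /= be2 scalerDl !scalerA; congr (_ + _ *: _).
exact: mulrC.
Qed.

End Tensor.

Theorem theorem4p3 (R : realType) (E1 E2 : vectType R[i])
    (L1 : lieSubalg E1) (L2 : lieSubalg E2)
    (nilL1 : lie_nilpotent L1) (nilL2 : lie_nilpotent L2) :
  let SpxSp := [set dual_pair a b | a in Sp (rep_incl L1)
                                  & b in Sp (rep_incl L2)] in
  [/\ Sp (rep_tens L1 L2) = SpxSp,
      forall k : nat, (k <= \dim L1 + \dim L2)%N ->
        sigma_delta (rep_tens L1 L2) k = SpxSp
    & forall k : nat, (k <= \dim L1 + \dim L2)%N ->
        sigma_pi (rep_tens L1 L2) k = SpxSp].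
Proof.
move=> SpxSp.
have two_neq0 : 2%:R != 0 :> R[i] by rewrite Num.Theory.pnatr_eq0.
have nilL := nilpotent_lie_prod nilL1 nilL2.
have -> : SpxSp = weights (rep_tens L1 L2).
  by rewrite /SpxSp !Sp_weights // -weights_tensor.
split=> [|k _|k lek]; first exact: Sp_weights.
  exact: sigma_delta_weights.
by apply: sigma_pi_weights; rewrite // dim_lie_prod !dim_lie_of_sub.
Qed.
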